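(* Let $n\geq 2$ be an integer and let $\boldsymbol{k}_1,\ldots,\boldsymbol{k}_n,\boldsymbol{l}$ be non-empty indices. Set $k\coloneqq \mathrm{wt}(\boldsymbol{k}_1)+\cdots+\mathrm{wt}(\boldsymbol{k}_n)+\mathrm{wt}(\boldsymbol{l})$ and \[ \mathrm{MPL}(n,k)\coloneqq\left\{\mathrm{Li}^{\mathrm{sh}}_{\boldsymbol{k}}(1,z_2,\dots, z_r) \ \middle| \ 1\leq r\leq k-2,\ \boldsymbol{k} \text{ admissible},\ \mathrm{wt}(\boldsymbol{k})=k-1,\ \mathrm{dep}(\boldsymbol{k})=r,\ z_2,\dots,z_r\in \{1,\tfrac{1}{2},\dots,\tfrac{1}{n}\}\right\}. \] Then the multiple connected sum $Z_n(\boldsymbol{k}_1;\dots;\boldsymbol{k}_n\mid\boldsymbol{l})$ can be written explicitly as a $\mathbb{Z}$-linear combination of elements of $\mathrm{MPL}(n,k)$.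
   Context: An index is a finite tuple $\boldsymbol{k}=(k_1,\dots,k_r)$ of positive integers; $r=\mathrm{dep}(\boldsymbol{k})$ is its depth and $\mathrm{wt}(\boldsymbol{k})=k_1+\cdots+k_r$ its weight; the empty tuple $\varnothing$ is an index of depth and weight $0$. An index is admissible if it is empty or $k_r\geq 2$. For an index $\boldsymbol{k}=(k_1,\dots,k_r)$ and complex numbers $z_1,\dots,z_r$ with $|z_i|\le 1$, the shuffle-type multiple polylogarithm is $\mathrm{Li}^{\mathrm{sh}}_{\boldsymbol{k}}(z_1,\dots,z_r)=\sum_{0=m_0<m_1<\cdots<m_r}\prod_{i=1}^r \frac{z_i^{m_i-m_{i-1}}}{m_i^{k_i}}$ (sum over integers). For non-negative integers $a_1,\dots,a_n$ put $C(a_1,\dots,a_n)=\frac{a_1!\cdots a_n!}{(a_1+\cdots+a_n)!}$. For indices $\boldsymbol{k}_j=(k^{(j)}_1,\dots,k^{(j)}_{r_j})$ ($1\le j\le n$) and $\boldsymbol{l}=(l_1,\dots,l_s)$ the multiple connected sum is \[ Z_n(\boldsymbol{k}_1;\dots;\boldsymbol{k}_n\mid\boldsymbol{l})=\sum C(m^{(1)}_{r_1},\dots,m^{(n)}_{r_n})\left[\prod_{j=1}^n\prod_{i=1}^{r_j}\frac{1}{(m^{(j)}_i)^{k^{(j)}_i}}\right]\left[q_s\prod_{i=1}^s\frac{1}{q_i^{l_i}}\right], \] where the sum runs over all integers with $0=m^{(j)}_0<m^{(j)}_1<\cdots<m^{(j)}_{r_j}$ for each $j$, and $0=q_0<q_1\le\cdots\le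 q_s=m^{(1)}_{r_1}+\cdots+m^{(n)}_{r_n}$. *)

(* Defs.v *)
From HB Require Import structures.
From mathcomp Require Import all_boot all_order all_algebra.
From mathcomp Require Import all_classical all_reals topology normedtype.
From mathcomp.analysis.showcase Require Import summability.
From mathcomp Require Import complex.

Set Implicit Arguments.
Unset Strict Implicit.
Unset Printing Implicit Defensive.

Import Order.TTheory GRing.Theory Num.Theory numFieldNormedType.Exports.

Local Open Scope classical_set_scope.
Local Open Scope ring_scope.

Definition is_index (k : seq nat) : bool := all (fun a => (0 < a)%N) k.

Definition dep (k : seq nat) : nat := size k.

Definition wt (k : seq nat) : nat := sumn k.

Definition admissible (k : seq nat) : bool := nilp k || (2 <= last 0 k)%N.

(* Unordered infinite sums: limits of the finite partial sums along the net of
   finite subsets of the index type. *)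
Definition series_cvg (K : numFieldType) (I : choiceType) (f : I -> K) : Prop :=
  cvg (partial_sum (f : I -> K^o) @ totally).

Definition series_sum (K : numFieldType) (I : choiceType) (f : I -> K) : K :=
  sum (f : I -> K^o).

(* m = [:: m_1; ...; m_r] with 0 = m_0 < m_1 < ... < m_r. *)
Definition increasing (r : nat) (m : seq nat) : bool :=
  (size m == r) && path ltn 0%N m.

(* Indices are shifted by one: for i < r, nth 0 m i is m_{i+1} and
   nth 0 (0 :: m) i is m_i. *)
Definition Li_sh (K : numFieldType) (k : seq nat) (z : seq K) : K :=
  series_sum (fun m : {m : seq nat | increasing (dep k) m} =>
    \prod_(i < dep k)
      (z`_i ^+ (nth 0%N (val m) i - nth 0%N (0%N :: val m) i)%N
       / (nth 0%N (val m) i)%:R ^+ nth 0%N k i)).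

Definition connector (K : numFieldType) (n : nat) (a : 'I_n -> nat) : K :=
  (\prod_(j < n) (a j)`!)%N%:R / ((\sum_(j < n) a j)%N`!)%:R.

(* path leq 1 q says 0 < q_1 <= ... <= q_s; last 0 is the last entry, with the
   convention that the last entry of the empty sequence is m_0 = q_0 = 0. *)
Definition Z_dom (n : nat) (k : 'I_n -> seq nat) (l : seq nat)
    (mq : {ffun 'I_n -> seq nat} * seq nat) : bool :=
  [&& [forall j, increasing (dep (k j)) (mq.1 j)],
      size mq.2 == dep l,
      path leq 1%N mq.2 &
      last 0%N mq.2 == (\sum_(j < n) last 0%N (mq.1 j))%N].

Definition Z_term (K : numFieldType) (n : nat) (k : 'I_n -> seq nat)
    (l : seq nat) (mq : {mq | Z_dom k l mq}) : K :=
  let m := (val mq).1 in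
  let q := (val mq).2 in
  connector K (fun j => last 0%N (m j))
  * (\prod_(j < n) \prod_(i < dep (k j))
       ((nth 0%N (m j) i)%:R ^+ nth 0%N (k j) i)^-1)
  * ((last 0%N q)%:R * \prod_(i < dep l) ((nth 0%N q i)%:R ^+ nth 0%N l i)^-1).

Definition Z_sum (K : numFieldType) (n : nat) (k : 'I_n -> seq nat)
    (l : seq nat) : K :=
  series_sum (@Z_term K n k l).

(* z lists z_2, ..., z_r. *)
Definition MPL (K : numFieldType) (n w : nat) : set K :=
  [set x | exists (k : seq nat) (z : seq K),
     [/\ is_index k,
         (1 <= dep k <= w - 2)%N,
         admissible k,
         wt k = (w - 1)%N &
         [/\ size z = (dep k - 1)%N,
             (forall y, y \in z ->
                exists2 j : nat, (1 <= j <= n)%N & y = j%:R^-1) &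
             x = Li_sh k (1 :: z)]]].

(* Main.v *)
Require Import Defs.
From mathcomp Require Import all_boot all_order all_algebra.
From mathcomp Require Import finmap.
From mathcomp Require Import all_classical all_reals topology normedtype.
From mathcomp Require Import ereal sequences esum.
From mathcomp.analysis.showcase Require Import summability.
From mathcomp Require Import complex.
From mathcomp Require Import ring lra zify.

(** Group the defining series by the last summation variables. The factor
    attached to [k_j] becomes the coefficient sequence of a multiple
    polylogarithm, the factor attached to [l] becomes a function [F] of the sum
    [M] of these variables, and the connector turns the product of the
    coefficient sequences into the convolution
    [(f, g) |-> \sum_(a + b = M) a! b! / M! * f a * g b]
    (on derivatives of generating functions, the ordinary convolution on
    [[0, t]]). A partial fraction decomposition of [1 / ((i - x) (j - (t - x)))],
    [1 / (x (j - (t - x)))] or [1 / (x (t - x))], read on coefficients, shows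
    that the [Z]-span of the polylogarithm coefficients with arguments
    [1, 1/2, ..., 1/p] is sent into the one with arguments [1, ..., 1/(p+q)].
    If the last entry of [l] is at least [2] this suffices, since multiplication
    by a truncated star sum preserves these spans. If it is [1], then [F] is a
    truncated sum, and summation by parts in one variable moves an entry [1] of
    [k_n] to the other factor (or trades one unit of [k_n] for a new entry [1]
    of the other factor), up to a term in which [l] has lost its final [1].
    All series have nonnegative terms, so the rearrangements are carried out in
    the extended reals, and finiteness comes along with the evaluation. *)

Set Implicit Arguments.
Unset Strict Implicit.
Unset Printing Implicit Defensive.

Import Order.TTheory GRing.Theory Num.Theory numFieldNormedType.Exports.

Local Open Scope classical_set_scope.
Local Open Scope ring_scope.

(** * Coefficient sequences of polylogarithms and their integral spans *)

Section Sequences.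
Context {R : realType}.
Implicit Types (f g h : nat -> R) (a b c d e i j m M p q w : nat).

Definition dpow e f M : R := (M%:R ^+ e)^-1 * f M.

(** On generating functions this is multiplication by [x / (j - x)], while [dpow 1] is integration
    against [dx / x], the constant term being dropped. Thus [dpow 1 (geo j f)] integrates against
    [dx / (j - x)], one step of an iterated integral. *)
Definition geo j f M : R := \sum_(m < M) j%:R^-1 ^+ (M - m) * f m.

Definition psum f M : R := \sum_(m < M.+1) f m.

(* Words are reversed: the head [(c, j)] of [s] stands for the last entry [k_r = c]
   with argument [z_r = 1 / j]. [Lcoef s M] is the part [m_r = M] of the series. *)
Fixpoint Lcoef (s : seq (nat * nat)) : nat -> R :=
  if s is x :: s' then dpow x.1 (geo x.2 (Lcoef s'))
  else fun M => (M == 0%N)%:R.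

(* The analogue for the chain [0 < q_1 <= ... <= q_s = M]; the value at [M = 0] of
   a nonempty word with positive entries is [0] because [0^-1 = 0]. *)
Fixpoint Scoef (l : seq nat) : nat -> R :=
  if l is c :: l' then dpow c (psum (Scoef l')) else fun M => (M == 0%N)%:R.

Definition cnct a b : R := (a`! * b`!)%N%:R / ((a + b)`!)%:R.

Definition conv f g M : R := \sum_(a < M.+1) cnct a (M - a) * f a * g (M - a)%N.

(** The largest denominator allowed is [p] and the weight is [w]. As words are reversed, the
    condition on the last pair means [z_1 = 1]. *)
Definition mpl_word p w (s : seq (nat * nat)) : bool :=
  [&& s != [::], all (fun x => (0 < x.1) && (0 < x.2 <= p))%N s,
      (last (0, 0) s).2 == 1%N & sumn (map fst s) == w].

(** Zero and differences suffice to generate an additive group, so the integral span is handled by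
    induction, without lists of coefficients. *)
Inductive zspan p w : (nat -> R) -> Prop :=
| zspan0 : zspan p w (fun=> 0)
| zspan_in s : mpl_word p w s -> zspan p w (Lcoef s)
| zspanB f g : zspan p w f -> zspan p w g -> zspan p w (f \- g).

Lemma zspanN p w f : zspan p w f -> zspan p w (\- f).
Proof.
move=> hf; rewrite (_ : \- f = (fun=> 0) \- f); first exact/zspanB/hf/zspan0.
by apply/funext => M /=; rewrite sub0r.
Qed.

Lemma zspanD p w f g : zspan p w f -> zspan p w g -> zspan p w (f \+ g).
Proof.
move=> hf hg; rewrite (_ : f \+ g = f \- (\- g)); first exact/zspanB/zspanN.
by apply/funext => M /=; rewrite opprK.
Qed.

Lemma zspan_map p w p' w' (op : (nat -> R) -> nat -> R) f :
    (forall g h, op (g \- h) = op g \- op h) ->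
    (forall s, mpl_word p w s -> zspan p' w' (op (Lcoef s))) ->
  zspan p w f -> zspan p' w' (op f).
Proof.
move=> opB opL; elim=> [||g h _ hg _ hh]; last by rewrite opB; exact: zspanB.
  (* Only compatibility with differences is assumed, so [op 0 = 0] is drawn from [0 = 0 - 0]. *)
  have -> : (fun=> 0) = (fun=> 0) \- (fun=> 0) :> (nat -> R).
    by apply/funext => M /=; rewrite subrr.
  rewrite opB (_ : _ \- _ = fun=> 0); first exact: zspan0.
  by apply/funext => M /=; rewrite subrr.
exact: opL.
Qed.

Lemma dpowB e f g : dpow e (f \- g) = dpow e f \- dpow e g.
Proof. by apply/funext => M; rewrite /dpow /= mulrBr. Qed.

Lemma geoB j f g : geo j (f \- g) = geo j f \- geo j g.
Proof.
apply/funext => M; rewrite /geo /= -sumrB.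
by apply: eq_bigr => m _; rewrite mulrBr.
Qed.

Lemma convBl f g h : conv (f \- g) h = conv f h \- conv g h.
Proof.
apply/funext => M; rewrite /conv /= -sumrB.
by apply: eq_bigr => a _; rewrite mulrBr mulrBl.
Qed.

Lemma convBr f g h : conv h (f \- g) = conv h f \- conv h g.
Proof.
apply/funext => M; rewrite /conv /= -sumrB.
by apply: eq_bigr => a _; rewrite mulrBr.
Qed.

Lemma dpow_add e e' f : dpow e (dpow e' f) = dpow (e + e') f.
Proof. by apply/funext => M; rewrite /dpow exprD invfM mulrA. Qed.

Lemma dpow_at0 e f : (0 < e)%N -> dpow e f 0 = 0.
Proof. by case: e => // e _; rewrite /dpow expr0n invr0 mul0r. Qed.

Lemma geo0 j f : geo j f 0 = 0.
Proof. by rewrite /geo big_ord0. Qed.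

Lemma geoS j f M : (0 < j)%N -> j%:R * geo j f M.+1 = geo j f M + f M.
Proof.
move=> j0; have jN0 : j%:R != 0 :> R by rewrite pnatr_eq0 -lt0n.
rewrite /geo big_ord_recr /= subSnn expr1 mulrDr mulrA divff // mul1r.
congr (_ + _); rewrite mulr_sumr; apply: eq_bigr => m _.
by rewrite subSn ?exprS 1?ltnW // !mulrA divff // mul1r.
Qed.

(** The recursion is the coefficient form of [(j - x) K = x f]. It recognises a sequence as
    [geo j f] without touching the defining sum; the identities for [geo] below are proved this
    way. *)
Lemma geo_uniq j f K : (0 < j)%N -> K 0%N = 0 ->
  (forall M, j%:R * K M.+1 = K M + f M) -> K = geo j f.
Proof.
move=> j0 K0 KS; have jN0 : j%:R != 0 :> R by rewrite pnatr_eq0 -lt0n.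
apply/funext; elim=> [|M IH]; first by rewrite K0 geo0.
by apply: (mulfI jN0); rewrite KS geoS // IH.
Qed.

Lemma mpl_word_mono p q w s : (p <= q)%N -> mpl_word p w s -> mpl_word q w s.
Proof.
move=> pq /and4P[sN0 sall slast sw]; apply/and4P; split=> //.
by apply: sub_all sall => x /and3P[-> -> /leq_trans->].
Qed.

Lemma zspan_mono p q w f : (p <= q)%N -> zspan p w f -> zspan q w f.
Proof.
move=> pq; elim=> [|s vs|g h _ hg _ hh]; [exact: zspan0| |exact: zspanB].
exact/zspan_in/(mpl_word_mono pq).
Qed.

Lemma zspan_dpow p w e f : zspan p w f -> zspan p (w + e) (dpow e f).
Proof.
apply: zspan_map => [g h|s]; first exact: dpowB.
case: s => [//|[c j] s] /and4P[_ /= /andP[/andP[c0 jp] sall] slast /eqP sw].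
rewrite dpow_add; apply: (@zspan_in _ _ ((e + c, j)%N :: s)).
apply/and4P; split=> //=; first by rewrite addn_gt0 c0 orbT jp.
  by case: (s) slast.
by rewrite -sw /=; apply/eqP; lia.
Qed.

Lemma zspan_geo p w e j f : (0 < e)%N -> (0 < j <= p)%N ->
  zspan p w f -> zspan p (w + e) (dpow e (geo j f)).
Proof.
move=> e0 jp; apply: (zspan_map (op := fun f => dpow e (geo j f))) => [g h|s].
  by rewrite geoB dpowB.
case: s => [//|x s] /and4P[_ sall slast /eqP sw].
apply: (@zspan_in _ _ [:: (e, j), x & s]); apply/and4P; split=> //.
  by rewrite /= e0 jp.
by rewrite -sw /=; apply/eqP; lia.
Qed.

(** * Convolution of coefficient sequences and partial fractions *)

Lemma cnctC a b : cnct a b = cnct b a.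
Proof. by rewrite /cnct mulnC addnC. Qed.

Lemma convC f g : conv f g = conv g f.
Proof.
apply/funext => M; rewrite /conv (reindex_inj rev_ord_inj) /=.
apply: eq_bigr => a _; have aM : (a <= M)%N by rewrite -ltnS.
by rewrite subSS subKn // cnctC mulrAC.
Qed.

Lemma conv_unit f : conv f (Lcoef [::]) = f.
Proof.
apply/funext => M; rewrite /conv big_ord_recr /= subnn big1 => [|a _].
  have M0 : M`!%:R != 0 :> R by rewrite pnatr_eq0 -lt0n fact_gt0.
  by rewrite add0r mulr1 /cnct addn0 muln1 divff // mul1r.
by rewrite subn_eq0 leqNgt ltn_ord mulr0.
Qed.

(** The factor [1 / (b + 1)] of [dpow 1 g] cancels against [(b + 1)!]. This formula and the next two
    share the weights [a! (M - a)! / (M + 1)!], so that convolutions can be compared term by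
    term. *)
Lemma conv_dpowr f g M : conv f (dpow 1 g) M.+1 =
  \sum_(a < M.+1) (a`! * (M - a)`!)%:R / (M.+1)`!%:R * f a * g (M - a).+1.
Proof.
rewrite /conv big_ord_recr /= subnn dpow_at0 // mulr0 addr0.
apply: eq_bigr => a _; have aM : (a <= M)%N by rewrite -ltnS.
rewrite subSn // /cnct /dpow expr1 addnS subnKC // [(M - a).+1`!]factS.
move: (M.+1)`! (a`!) ((M - a)`!) => u v t; rewrite !natrM; set x := (M - a).+1%:R.
have x0 : x != 0 by rewrite /x pnatr_eq0.
have -> (z r s r' s' : R) :
  r * (x * s) * z * r' * (x^-1 * s') = (x * x^-1) * (r * s * z * r' * s') by ring.
by rewrite divff // mul1r.
Qed.

Lemma conv_dpowl f g M : conv (dpow 1 f) g M.+1 =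
  \sum_(a < M.+1) (a`! * (M - a)`!)%:R / (M.+1)`!%:R * f a.+1 * g (M - a)%N.
Proof.
rewrite convC conv_dpowr (reindex_inj rev_ord_inj) /=.
apply: eq_bigr => a _; have aM : (a <= M)%N by rewrite -ltnS.
by rewrite subSS subKn // [((M - a)`! * _)%N]mulnC mulrAC.
Qed.

Lemma conv_dpow2 f g M : (M.+2)%:R * conv (dpow 1 f) (dpow 1 g) M.+2 =
  \sum_(a < M.+1) (a`! * (M - a)`!)%:R / (M.+1)`!%:R * f a.+1 * g (M - a).+1.
Proof.
rewrite conv_dpowl big_ord_recr /= subnn dpow_at0 // mulr0 addr0 mulr_sumr.
apply: eq_bigr => a _; have aM : (a <= M)%N by rewrite -ltnS.
rewrite subSn // /dpow expr1 [(M.+2)`!]factS [(M - a).+1`!]factS.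
move: (M.+1)`! (a`!) ((M - a)`!) => u v t; rewrite !natrM invfM.
set x := (M - a).+1%:R; set y := M.+2%:R.
have x0 : x != 0 by rewrite /x pnatr_eq0.
have y0 : y != 0 by rewrite /y pnatr_eq0.
have -> (z r s r' s' : R) :
  y * (r * (x * s) * (y^-1 * z) * r' * (x^-1 * s')) =
  (y * y^-1) * (x * x^-1) * (r * s * z * r' * s') by ring.
by rewrite !divff // !mul1r.
Qed.

Lemma conv_dpow_at1 f g : conv (dpow 1 f) (dpow 1 g) 1 = 0.
Proof. by rewrite conv_dpowl big_ord1 dpow_at0 // mulr0. Qed.

Lemma conv_at0 f g : conv f g 0 = f 0%N * g 0%N.
Proof. by rewrite /conv big_ord1 /cnct addn0 fact0 divff ?mul1r ?oner_neq0. Qed.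

(** Write [M = a + (M - a)]; each summand cancels one division. This is [1 / (x (t - x)) = (1 / x +
    1 / (t - x)) / t]. The vanishing at [0] takes care of the two extreme terms, where [dpow 1] is
    [0] by convention. *)
Lemma conv_dpow_split f g M : f 0%N = 0 -> g 0%N = 0 ->
  M%:R * conv (dpow 1 f) (dpow 1 g) M =
  conv f (dpow 1 g) M + conv (dpow 1 f) g M.
Proof.
move=> f0 g0; rewrite /conv mulr_sumr -big_split; apply: eq_bigr => a _ /=.
rewrite /dpow !expr1; have aM : (a <= M)%N by rewrite -ltnS.
case: (posnP a) => [->|a0]; first by rewrite f0 !(mulr0, mul0r) addr0.
case: (posnP (M - a)%N) => [->|b0]; first by rewrite g0 !(mulr0, mul0r) addr0.
rewrite -[in M%:R](subnKC aM) natrD.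
have x0 : a%:R != 0 :> R by rewrite pnatr_eq0 -lt0n.
have y0 : (M - a)%:R != 0 :> R by rewrite pnatr_eq0 -lt0n.
move: (a%:R : R) ((M - a)%:R : R) x0 y0 (cnct _ _) => x y x0 y0 z.
by field; rewrite x0.
Qed.

Lemma dpow1_of f h : h 0%N = 0 -> (forall M, M%:R * h M = f M) -> h = dpow 1 f.
Proof.
move=> h0 hf; apply/funext; case=> [|M]; first by rewrite h0 dpow_at0.
by rewrite /dpow -hf expr1 mulKf // pnatr_eq0.
Qed.

Lemma conv_dpow_dpow f g : f 0%N = 0 -> g 0%N = 0 ->
  conv (dpow 1 f) (dpow 1 g) =
  dpow 1 (conv f (dpow 1 g) \+ conv (dpow 1 f) g).
Proof.
move=> f0 g0; apply: dpow1_of => [|M]; first by rewrite conv_at0 dpow_at0 // mul0r.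
by rewrite conv_dpow_split.
Qed.

(** With [y = t - x] this is [1 / (x (i - y)) = (1 / x - 1 / (i - y)) / (i - t)]. *)
Lemma conv_dpow_geo f g i : (0 < i)%N -> f 0%N = 0 ->
  conv (dpow 1 f) (dpow 1 (geo i g)) =
  dpow 1 (geo i (conv (dpow 1 f) g \- conv f (dpow 1 (geo i g)))).
Proof.
move=> i0 f0; apply: dpow1_of => [|M]; first by rewrite conv_at0 dpow_at0 // mul0r.
(* Multiplication by [M] undid the outer [dpow 1]; the recursion of [geo] remains. Its first
   instance is separate because [conv_dpow2] starts at index [2]. *)
move: M; apply/funeqP; apply: geo_uniq => // [|[|M] /=]; first by rewrite mul0r.
  by rewrite conv_dpow_at1 !conv_at0 f0 dpow_at0 // !(mulr0, mul0r) subrr addr0.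
rewrite [X in _ = X + _]conv_dpow_split ?geo0 //.
have -> (x y z : R) : x + y + (z - x) = y + z by ring.
rewrite conv_dpow2 !conv_dpowl -big_split mulr_sumr; apply: eq_bigr => a _ /=.
by rewrite mulrCA geoS // -mulrDr.
Qed.

(** With [y = t - x] this is [1 / ((j - x) (i - y)) = (1 / (j - x) + 1 / (i - y)) / (i + j - t)].
    Here denominators add up, which is how arguments other than [1] arise. *)
Lemma conv_geo_geo f g i j : (0 < i)%N -> (0 < j)%N ->
  conv (dpow 1 (geo j f)) (dpow 1 (geo i g)) =
  dpow 1 (geo (i + j)
    (conv (dpow 1 (geo j f)) g \+ conv f (dpow 1 (geo i g)))).
Proof.
move=> i0 j0; apply: dpow1_of => [|M]; first by rewrite conv_at0 dpow_at0 // mul0r.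
move: M; apply/funeqP; apply: geo_uniq => // [|| [|M] /=].
- by rewrite addn_gt0 i0.
- by rewrite mul0r.
- by rewrite conv_dpow_at1 !conv_at0 !dpow_at0 // !(mulr0, mul0r) !addr0.
rewrite [X in _ = X + _]conv_dpow_split ?geo0 // conv_dpow2 !conv_dpowl !conv_dpowr.
rewrite -!big_split mulr_sumr; apply: eq_bigr => a _ /=.
rewrite natrD mulrDl mulrCA geoS // [X in _ + _ * X]mulrAC.
rewrite [X in _ + X]mulrCA geoS //; move: (_ / _) => *; ring.
Qed.

Lemma Lcoef_cons0 x s : Lcoef (x :: s) 0 = 0.
Proof. by rewrite /= /dpow geo0 mulr0. Qed.

Lemma mpl_word_cons p w c j s : mpl_word p w ((c, j) :: s) ->
  [/\ (0 < c <= w)%N, (0 < j <= p)%N &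
      s = [::] /\ w = c /\ j = 1%N \/ mpl_word p (w - c) s].
Proof.
case/and4P => _ /= /andP[/andP[c0 jp] sall] slast /eqP sw; split=> //.
  by rewrite c0 -sw leq_addr.
case: s sall slast sw => [|x s] sall /= slast sw.
  by left; rewrite -sw addn0 (eqP slast).
by right; apply/and4P; split=> //=; apply/eqP; lia.
Qed.

Lemma mpl_word_pred p w c j s :
  mpl_word p w ((c.+2, j) :: s) -> mpl_word p w.-1 ((c.+1, j) :: s).
Proof.
case/and4P => _ /= /andP[jp sall] slast /eqP sw; apply/and4P; split=> //=.
- by apply/andP; split.
- by case: (s) slast.
- by apply/eqP; lia.
Qed.

Lemma Lcoef_pred c j s :
  Lcoef ((c.+1, j) :: s) = dpow 1 (Lcoef ((c, j) :: s)).
Proof. by rewrite /= dpow_add. Qed.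

(* Induction on the total weight, by [conv_dpow_dpow], [conv_dpow_geo] or
   [conv_geo_geo] according to which of the two last exponents is [1]. *)
Lemma zspan_conv_in p q w v s t : mpl_word p w s -> mpl_word q v t ->
  zspan (p + q) (w + v) (conv (Lcoef s) (Lcoef t)).
Proof.
have [N] := ubnP (w + v); elim: N p q w v s t => // N IHN p q w v s t wv vs vt.
(* Dropping the last entry may leave the empty word, which is not an [mpl_word]; but convolution
   with it is the identity, so the other word remains. *)
have tail p' q' w' v' c j s' t' : (w' + v' < N.+1)%N ->
    mpl_word p' w' ((c, j) :: s') -> mpl_word q' v' t' ->
    zspan (p' + q') (w' - c + v') (conv (Lcoef s') (Lcoef t')).
  move=> wv' /mpl_word_cons[cw _ [[-> [-> _]]|vs']] vt'.
    rewrite subnn convC conv_unit; apply: zspan_mono (zspan_in vt').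
    exact: leq_addl.
  by apply: IHN => //; lia.
have step p' q' w' v' c i j s' t' : (w' + v' < N.+1)%N ->
    mpl_word p' w' ((c.+2, j) :: s') -> mpl_word q' v' ((1%N, i) :: t') ->
    zspan (p' + q') (w' + v')
      (conv (Lcoef ((c.+2, j) :: s')) (Lcoef ((1%N, i) :: t'))).
  move=> wv' vs' vt'.
  have [/andP[_ cw] _ _] := mpl_word_cons vs'.
  have [/andP[_ dv] /andP[i0 iq] _] := mpl_word_cons vt'.
  rewrite Lcoef_pred [Lcoef ((1%N, i) :: t')]/=.
  rewrite conv_dpow_geo // -?Lcoef_pred; last exact: Lcoef_cons0.
  rewrite (_ : (w' + v' = w' + v' - 1 + 1)%N); last by lia.
  apply: zspan_geo => //; first by rewrite i0 (leq_trans iq) ?leq_addl.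
  apply: zspanB.
    have := tail _ _ _ _ _ _ _ _ _ vt' vs'.
    rewrite convC [(q' + p')%N]addnC (_ : (v' - 1 + w' = w' + v' - 1)%N); last by lia.
    by apply; lia.
  rewrite (_ : (w' + v' - 1 = w'.-1 + v')%N); last by lia.
  by apply: (IHN _ _ _ _ _ ((1%N, i) :: t')) => //; [lia|exact: mpl_word_pred].
case: s vs => [//|[c j] s] vs; case: t vt => [//|[d i] t] vt.
have [/andP[c0 cw] /andP[j0 jp] _] := mpl_word_cons vs.
have [/andP[d0 dv] /andP[i0 iq] _] := mpl_word_cons vt.
case: c c0 cw vs => [//|[|c]] _ cw vs; case: d d0 dv vt => [//|[|d]] _ dv vt.
- rewrite ![Lcoef ((_, _) :: _)]/= conv_geo_geo //.
  rewrite (_ : (w + v = w + v - 1 + 1)%N); last by lia.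
  apply: zspan_geo => //; first by lia.
  apply: zspanD.
    have := tail _ _ _ _ _ _ _ _ _ vt vs.
    rewrite convC [(q + p)%N]addnC (_ : (v - 1 + w = w + v - 1)%N); last by lia.
    by apply; lia.
  have := tail _ _ _ _ _ _ _ _ _ vs vt.
  by rewrite (_ : (w - 1 + v = w + v - 1)%N); [apply|lia].
- by rewrite convC addnC [(w + v)%N]addnC; apply: step => //; lia.
- exact: step.
- rewrite (Lcoef_pred c.+1) (Lcoef_pred d.+1) conv_dpow_dpow; try exact: Lcoef_cons0.
  rewrite (_ : (w + v = w + v - 1 + 1)%N); last by lia.
  apply: zspan_dpow; apply: zspanD; rewrite -Lcoef_pred.
    rewrite (_ : (w + v - 1 = w.-1 + v)%N); last by lia.
    by apply: IHN => //; [lia|exact: mpl_word_pred].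
  rewrite (_ : (w + v - 1 = w + v.-1)%N); last by lia.
  by apply: IHN => //; [lia|exact: mpl_word_pred].
Qed.

Lemma zspan_conv p q w v f g : zspan p w f -> zspan q v g ->
  zspan (p + q) (w + v) (conv f g).
Proof.
move=> hf hg; move: hf; apply: (zspan_map (op := conv^~ g)) => [*|s vs].
  exact: convBl.
move: hg; apply: zspan_map => [*|t vt]; first exact: convBr.
exact: zspan_conv_in.
Qed.

(** * Multiplication by truncated star sums *)

Lemma psumS f M : psum f M.+1 = psum f M + f M.+1.
Proof. by rewrite /psum big_ord_recr. Qed.

(** Let [q] be the variable of [g]. Either [q = M], or [q <= m < M], or [m < q < M]; in the last
    case [j ^- (M - m)] factors as [j ^- (M - q) * j ^- (q - m)]. *)
Lemma geo_mul_psum j f g M : (0 < j)%N ->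
  geo j f M * psum g M = geo j f M * g M +
    geo j ((fun m => f m * psum g m) \+ (fun m => geo j f m * g m)) M.
Proof.
move=> j0; apply/eqP; rewrite addrC -subr_eq -mulrBr; apply/eqP.
move: M; apply/funeqP; apply: geo_uniq => // [|M] /=; first by rewrite geo0 mul0r.
by rewrite psumS addrK mulrA geoS //; ring.
Qed.

Lemma psum_unit M : psum (Lcoef [::]) M = 1.
Proof. by rewrite /psum big_ord_recl /= big1 ?addr0. Qed.

Lemma zspan_star p w s l : mpl_word p w s -> all (leq 1) l ->
  zspan p (w + sumn l) (fun M => Lcoef s M * psum (Scoef l) M).
Proof.
elim: l w s => [|c l IHl] w s vs /=.
  move=> _; rewrite addn0 (_ : (fun M => _) = Lcoef s); first exact: zspan_in.
  by apply/funext => M; rewrite psum_unit mulr1.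
case/andP => c0 lpos; elim: s w vs => [//|[e j] s IHs] w vs.
have [/andP[e0 ew] jp vs'] := mpl_word_cons vs; have /andP[j0 _] := jp.
(* The largest star variable equals [m_r] and the exponents merge, or is at most [m_(r-1)], or lies
   strictly between the two and becomes a new entry with the same argument [1 / j]. *)
rewrite (_ : (fun M => _) =
  dpow c (fun M => Lcoef ((e, j) :: s) M * psum (Scoef l) M) \+
  dpow e (geo j ((fun m => Lcoef s m * psum (Scoef (c :: l)) m) \+
                 (fun m => Lcoef ((c, j) :: s) m * psum (Scoef l) m)))); last first.
  apply/funext => M; rewrite [in RHS]/dpow [in LHS]/= [in LHS]/dpow -mulrA.
  rewrite geo_mul_psum // mulrDr; congr (_ + _ * geo j _ M).
    by rewrite /= /dpow; ring.
  by apply/funext => m /=; rewrite /dpow; congr (_ + _); ring.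
apply: zspanD.
  by rewrite [(c + _)%N]addnC addnA; apply: zspan_dpow; exact: IHl.
rewrite (_ : (w + (c + sumn l) = w - e + (c + sumn l) + e)%N); last by lia.
apply: zspan_geo => //; apply: zspanD; last first.
  rewrite addnA; apply: IHl => //; case: vs' => [[-> [-> ->]]|].
    rewrite subnn; apply/and4P; split=> //=; last by rewrite addn0.
    by rewrite c0 /=; lia.
  case/and4P => sN0 sall slast /eqP sw; apply/and4P; split=> //=.
  - by rewrite c0 jp.
  - by case: (s) sN0 slast.
  - by rewrite sw addnC.
case: vs' => [[-> _]|vs']; last exact: IHs.
(* For empty [s] only [m = 0] could contribute, and there the nonempty star sum vanishes. *)
rewrite (_ : (fun m => _) = fun=> 0); first exact: zspan0.
apply/funext => -[|m] /=; last by rewrite mul0r.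
by rewrite /psum big_ord1 dpow_at0 ?mulr0.
Qed.

Lemma zspan_mul_psum p w f l : zspan p w f -> all (leq 1) l ->
  zspan p (w + sumn l) (fun M => f M * psum (Scoef l) M).
Proof.
move=> hf lpos; move: hf.
apply: (zspan_map (op := fun f M => f M * psum (Scoef l) M)) => [g h|s vs].
  by apply/funext => M /=; rewrite mulrBl.
exact: zspan_star.
Qed.

End Sequences.

(** * Sums of nonnegative terms in the extended reals *)

Section ExtendedSums.
Context {R : realType}.
Local Open Scope ereal_scope.

Lemma esumT_pair (T1 T2 : choiceType) (a : T1 -> T2 -> \bar R) :
  (forall i j, 0 <= a i j) ->
  \esum_(i in [set: T1]) \esum_(j in [set: T2]) a i j =
  \esum_(x in [set: T1 * T2]) a x.1 x.2.
Proof.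
move=> a0; rewrite esum_esum //; congr esum.
by apply/seteqP; split.
Qed.

Lemma reindex_esumT (T T' : choiceType) (e : T -> T') (a : T' -> \bar R) :
  bijective e -> \esum_(j in [set: T']) a j = \esum_(i in [set: T]) a (e i).
Proof.
case=> e' eK e'K; apply: reindex_esum; split=> //.
- by move=> x y _ _ /(can_inj eK).
- by move=> y _; exists (e' y).
Qed.

Lemma esumT_exchange (T1 T2 : choiceType) (a : T1 -> T2 -> \bar R) :
  (forall i j, 0 <= a i j) ->
  \esum_(i in [set: T1]) \esum_(j in [set: T2]) a i j =
  \esum_(j in [set: T2]) \esum_(i in [set: T1]) a i j.
Proof.
move=> a0; rewrite !esumT_pair //.
rewrite (reindex_esumT (e := fun x : T2 * T1 => (x.2, x.1))) //.
by exists (fun x => (x.2, x.1)) => -[].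
Qed.

Lemma esumZl (T : choiceType) (D : set T) (c : R) (a : T -> \bar R) :
  (0 <= c)%R -> (forall i, 0 <= a i) ->
  \esum_(i in D) (c%:E * a i) = c%:E * \esum_(i in D) a i.
Proof.
have le_Z (d : R) (b : T -> \bar R) : (0 <= d)%R -> (forall i, 0 <= b i) ->
    \esum_(i in D) (d%:E * b i) <= d%:E * \esum_(i in D) b i.
  move=> d0 b0; apply: ge_ereal_sup => /= _ [X [finX XD] <-].
  rewrite -ge0_mule_fsumr //.
  by apply: lee_wpmul2l; [rewrite lee_fin|apply: ereal_sup_ubound; exists X].
rewrite le_eqVlt => /predU1P[<-|c0] a0.
  by rewrite mul0e esum1 // => i _; rewrite mul0e.
apply/le_anti/andP; split; first by apply: le_Z => //; exact: ltW.
(* The converse inequality is the first one for the factor [c^-1]. *)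
rewrite -lee_pdivlMl //.
apply: le_trans (le_Z _ _ _ _); last 2 first.
- by rewrite invr_ge0 ltW.
- by move=> i; rewrite mule_ge0 // lee_fin ltW.
apply: le_esum => i Di.
by rewrite muleA -EFinM mulVf ?gt_eqF // mul1e.
Qed.

Lemma esum_antidiagonal (a : nat -> nat -> R) :
  (forall i j, 0 <= a i j)%R ->
  \esum_(i in [set: nat]) \esum_(j in [set: nat]) (a i j)%:E =
  \esum_(M in [set: nat]) (\sum_(i < M.+1) a i (M - i)%N)%:E.
Proof.
move=> a0; rewrite esumT_pair /=; last by move=> i j; rewrite lee_fin.
(* Rows are extended by zero, so that [(i, j) |-> (i + j, i)] reindexes the support inside all
   pairs. *)
pose b M i : \bar R := (if (i <= M)%N then a i (M - i)%N else 0)%:E.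
have b0 M i : 0 <= b M i by rewrite /b lee_fin; case: ifP.
transitivity (\esum_(M in [set: nat]) \esum_(i in [set: nat]) b M i).
  rewrite esumT_pair //.
  apply/esym; rewrite (esumID [set x | (x.2 <= x.1)%N] [set: nat * nat]) //.
  rewrite [X in _ + X]esum1 ?adde0; last first.
    by move=> -[M i] /= [_ /negP]; rewrite /b /= => /negPf ->.
  rewrite (reindex_esum [set: nat * nat] _ (fun x => (x.1 + x.2, x.1)%N)).
    by apply: eq_esum => -[i j] _ /=; rewrite /b /= leq_addr addKn.
  split=> /=.
  - by move=> [i j] _ /=; rewrite leq_addr.
  - by move=> [i j] [i' j'] _ _ /= [] /[swap] -> /addnI ->.
  - by move=> [M i] [_ /= iM]; exists (i, M - i)%N => //=; rewrite subnKC.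
apply: eq_esum => M _.
rewrite (esumID [set i | (i <= M)%N]) // [X in _ + X]esum1 ?adde0; last first.
  by move=> i [_ /negP]; rewrite /b /= => /negPf ->.
rewrite setTI (_ : [set i | (i <= M)%N] = `I_M.+1) //.
rewrite esum_fset // -fsbig_ord -sumEFin; apply: eq_bigr => i _.
by rewrite /b -ltnS ltn_ord.
Qed.

End ExtendedSums.

(** * Positivity, decay of the connector, and summation by parts *)

Section ConnectedSums.
Context {R : realType}.
Implicit Types (f g h F : nat -> R) (a b c d e i j m M p q w : nat).

Lemma dpow_ge0 e f M : (forall m, 0 <= f m) -> 0 <= dpow e f M.
Proof. by move=> f0; rewrite /dpow mulr_ge0 // invr_ge0 exprn_ge0. Qed.

Lemma geo_ge0 j f M : (forall m, 0 <= f m) -> 0 <= geo j f M.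
Proof.
by move=> f0; apply: sumr_ge0 => m _; rewrite mulr_ge0 // exprn_ge0 // invr_ge0.
Qed.

Lemma psum_ge0 f M : (forall m, 0 <= f m) -> 0 <= psum f M.
Proof. by move=> f0; exact: sumr_ge0. Qed.

Lemma Lcoef_ge0 s M : 0 <= Lcoef s M :> R.
Proof.
elim: s M => [|x s IHs] M /=; rewrite ?ler0n // dpow_ge0 // => m.
exact: geo_ge0.
Qed.

Lemma Scoef_ge0 l M : 0 <= Scoef l M :> R.
Proof.
elim: l M => [|c l IHl] M /=; rewrite ?ler0n // dpow_ge0 // => m.
exact: psum_ge0.
Qed.

Lemma cnct_ge0 a b : 0 <= cnct a b :> R.
Proof. by rewrite /cnct mulr_ge0 // invr_ge0. Qed.

Lemma conv_ge0 f g M : (forall m, 0 <= f m) -> (forall m, 0 <= g m) ->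
  0 <= conv f g M.
Proof. by move=> f0 g0; apply: sumr_ge0 => a _; rewrite !mulr_ge0 // cnct_ge0. Qed.

Lemma geo1S f M : geo 1 f M.+1 = geo 1 f M + f M.
Proof. by rewrite -geoS // mul1r. Qed.

Lemma geo1_le f M N : (forall m, 0 <= f m) -> (M <= N)%N -> geo 1 f M <= geo 1 f N.
Proof.
move=> f0 /subnK <-; elim: (_ - _)%N => [//|d IHd].
by rewrite addSn geo1S (le_trans IHd) // lerDl.
Qed.

Lemma psum_le f M N : (forall m, 0 <= f m) -> (M <= N)%N -> psum f M <= psum f N.
Proof.
move=> f0 /subnK <-; elim: (_ - _)%N => [//|d IHd].
by rewrite addSn psumS (le_trans IHd) // lerDl.
Qed.

Lemma cnctS a b : (a + b).+1%:R * cnct a b.+1 = b.+1%:R * cnct a b :> R.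
Proof.
rewrite /cnct addnS !factS; move: (_`!) (fact_gt0 (a + b)) => u u0.
rewrite !natrM invfM.
have x0 : (a + b).+1%:R != 0 :> R by rewrite pnatr_eq0.
have -> (x y z t v : R) :
    x * (y * (z * t) * (x^-1 * v)) = (x * x^-1) * (z * (y * t * v)).
  by ring.
by rewrite divff // mul1r.
Qed.

Lemma cnct0 a : cnct a 0 = 1 :> R.
Proof.
by rewrite /cnct addn0 fact0 muln1 divff // pnatr_eq0 -lt0n fact_gt0.
Qed.

(** Division by [b + 1] makes the connector a discrete derivative in [b]; this drives the summation
    by parts. *)
Lemma cnct_diff a b :
  a%:R * (b.+1%:R^-1 * cnct a b.+1) = cnct a b - cnct a b.+1 :> R.
Proof.
have b0 : b.+1%:R != 0 :> R by rewrite pnatr_eq0.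
apply: (mulfI b0); rewrite mulrBr -cnctS -addnS natrD.
move: (b.+1%:R : R) b0 => y y0; field.
exact: y0.
Qed.

(** The right-hand side is the value at [a = 1]. The decay in [b] disposes of the boundary terms. *)
Lemma cnct_le a b : (0 < a)%N -> cnct a b <= b.+1%:R^-1 :> R.
Proof.
move=> a0; elim: b => [|b IHb]; first by rewrite cnct0 invr1.
have x0 : 0 < (a + b).+1%:R :> R by rewrite ltr0n.
rewrite -(ler_pM2l x0) cnctS.
have : b.+1%:R * cnct a b <= 1 :> R.
  by rewrite mulrC -ler_pdivlMr ?ltr0n // div1r.
move/le_trans; apply; rewrite ler_pdivlMr ?ltr0n // mul1r ler_nat.
by lia.
Qed.

(** Comparison of partial sums up to [eps] also covers divergent series, so equalities of sums need
    no prior convergence. *)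
Lemma esum_le_approx (u v : nat -> R) :
    (forall m, 0 <= u m) -> (forall m, 0 <= v m) ->
    (forall N eps, 0 < eps -> exists K,
       \sum_(m < N) v m <= \sum_(m < K) u m + eps) ->
  (\esum_(m in [set: nat]) (v m)%:E <= \esum_(m in [set: nat]) (u m)%:E)%E.
Proof.
move=> u0 v0 uv.
have u0' n : (0 <= (u n)%:E)%E by rewrite lee_fin.
have v0' n : (0 <= (v n)%:E)%E by rewrite lee_fin.
rewrite -!nneseries_esumT //.
apply: lime_le; first exact: is_cvg_nneseries.
apply: nearW => N; apply/lee_addgt0Pr => eps eps0.
have [K hK] := uv N eps eps0.
rewrite big_mkord sumEFin; apply: (@le_trans _ _ (\sum_(m < K) u m + eps)%:E).
  by rewrite lee_fin.
rewrite EFinD leeD2r // -sumEFin -(big_mkord xpredT (fun m => (u m)%:E)).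
exact: nneseries_lim_ge.
Qed.

(* Summation by parts: the boundary terms [cnct a N * geo 1 f N * psum F (a + N)]
   are absorbed by the tail of the left-hand series, since [cnct a K] tends to
   [0]; no growth bound on [f] and [F] is needed. *)
Lemma transport_row a f F : (0 < a)%N ->
    (forall m, 0 <= f m) -> (forall m, 0 <= F m) ->
  (\esum_(b in [set: nat])
     (cnct a b * dpow 1 (geo 1 f) b * psum F (a + b))%:E =
   \esum_(b in [set: nat]) (a%:R^-1 * (cnct a b * f b * psum F (a + b)))%:E +
   \esum_(b in [set: nat]) (a%:R^-1 * (cnct a b * dpow 1 (geo 1 f) b *
                               ((a + b)%:R * F (a + b)%N)))%:E)%E.
Proof.
move=> a0 f0 F0.
pose u b := cnct a b * dpow 1 (geo 1 f) b * psum F (a + b).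
pose v1 b := a%:R^-1 * (cnct a b * f b * psum F (a + b)).
pose v2 b := a%:R^-1 * (cnct a b * dpow 1 (geo 1 f) b *
                        ((a + b)%:R * F (a + b)%N)).
pose D N := a%:R^-1 * (cnct a N * geo 1 f N * psum F (a + N)).
have ia0 : 0 <= a%:R^-1 :> R by rewrite invr_ge0.
have g0 m : 0 <= geo 1 f m by exact: geo_ge0.
have d0 m : 0 <= dpow 1 (geo 1 f) m by exact: dpow_ge0.
have p0 m : 0 <= psum F m by exact: psum_ge0.
have u0 m : 0 <= u m by rewrite /u !mulr_ge0 // cnct_ge0.
have v10 m : 0 <= v1 m by rewrite /v1 !mulr_ge0 // cnct_ge0.
have v20 m : 0 <= v2 m by rewrite /v2 !mulr_ge0 // cnct_ge0.
have D0 m : 0 <= D m by rewrite /D !mulr_ge0 // cnct_ge0.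
have aN0 : a%:R != 0 :> R by rewrite pnatr_eq0 -lt0n.
have uE b : u b.+1 = a%:R^-1 * ((cnct a b - cnct a b.+1) * geo 1 f b.+1 *
                                psum F (a + b.+1)).
  rewrite -cnct_diff /u /dpow expr1; move: (b.+1%:R^-1 : R) => x.
  have -> (y z t : R) : a%:R^-1 * (a%:R * (x * y) * z * t) =
    (a%:R^-1 * a%:R) * (y * (x * z) * t) by ring.
  by rewrite mulVf // mul1r.
(* Abel summation in finite form, with boundary term [D N]. *)
have partial N : \sum_(b < N.+1) u b + D N =
    \sum_(b < N) v1 b + \sum_(b < N.+1) v2 b.
  elim: N => [|N IHN].
    rewrite !big_ord1 big_ord0 /u /v2 /D geo0 dpow_at0 //.
    by rewrite !(mulr0, mul0r) !addr0.
  rewrite big_ord_recr [in RHS]big_ord_recr /= [\sum_(b < N.+2) v2 b]big_ord_recr /=.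
  rewrite addrACA -IHN.
  have -> : v2 N.+1 = a%:R^-1 * (cnct a N * geo 1 f N.+1 * F (a + N.+1)%N).
    rewrite /v2 /dpow expr1; congr (_ * _).
    have := cnctS a N; rewrite -addnS => h.
    have n0 : N.+1%:R != 0 :> R by rewrite pnatr_eq0.
    transitivity ((a + N.+1)%:R * cnct a N.+1 *
                  (N.+1%:R^-1 * geo 1 f N.+1 * F (a + N.+1)%N)); first by ring.
    rewrite h; have -> (x y z t : R) : x * y * (x^-1 * z * t) =
      (x^-1 * x) * (y * z * t) by ring.
    by rewrite mulVf // mul1r.
  rewrite uE /D /v1 geo1S addnS psumS; ring.
(* Telescoping writes [cnct a N] as differences plus [cnct a (N + K)]. As [geo 1 f] and [psum F]
   increase, the differences are dominated by further terms of [u]. *)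
have tail N K : \sum_(b < N.+1) u b + D N <=
    \sum_(b < (N + K).+1) u b +
      a%:R^-1 * (cnct a (N + K) * geo 1 f N * psum F (a + N)).
  elim: K => [|K IHK]; first by rewrite addn0.
  rewrite (le_trans IHK) // addnS [X in _ <= X + _]big_ord_recr /=.
  rewrite -[leRHS]addrA lerD2l uE.
  rewrite -mulrDr ler_wpM2l //.
  apply: (@le_trans _ _ ((cnct a (N + K) - cnct a (N + K).+1) * geo 1 f N *
     psum F (a + N) + cnct a (N + K).+1 * geo 1 f N * psum F (a + N))).
    by rewrite -!mulrDl subrK.
  have c0 : 0 <= cnct a (N + K) - cnct a (N + K).+1 :> R.
    by rewrite -cnct_diff !mulr_ge0 ?invr_ge0 // cnct_ge0.
  rewrite lerD2r ler_pM ?mulr_ge0 //.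
    by rewrite ler_wpM2l // geo1_le //; lia.
  by rewrite psum_le //; lia.
rewrite -esumD; [|by move=> m _; rewrite lee_fin v10
  |by move=> m _; rewrite lee_fin v20].
under [in RHS]eq_esum do rewrite -EFinD.
apply/le_anti/andP; split.
  apply: (esum_le_approx (v := u) (u := fun b => v1 b + v2 b)) => //.
    by move=> m; rewrite addr_ge0.
  move=> N eps eps0; exists N; case: N => [|N].
    by rewrite !big_ord0 add0r ltW.
  rewrite big_split /= [\sum_(b < N.+1) v1 b]big_ord_recr /=.
  rewrite [X in X + eps]addrAC -partial -!addrA lerDl.
  by rewrite !addr_ge0 // ltW.
apply: (esum_le_approx (u := u) (v := fun b => v1 b + v2 b)) => //.
  by move=> m; rewrite addr_ge0.
move=> N eps eps0.
(* The remainder is at most [B / (N + K + 1)], hence at most [eps] once [K >= B / eps]. *)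
pose B := a%:R^-1 * (geo 1 f N * psum F (a + N)).
have B0 : 0 <= B by rewrite !mulr_ge0.
have [K hK] : exists K : nat, B / eps <= K%:R.
  by eexists; exact/ltW/truncnS_gt.
exists (N + K).+1.
rewrite big_split /=.
apply: (@le_trans _ _ (\sum_(b < N) v1 b + \sum_(b < N.+1) v2 b)).
  by rewrite lerD2l big_ord_recr /= lerDl.
rewrite -partial (le_trans (tail N K)) // lerD2l.
rewrite [leLHS](_ : _ = cnct a (N + K) * B); last by rewrite /B; ring.
apply: (@le_trans _ _ ((N + K).+1%:R^-1 * B)).
  by rewrite ler_wpM2r // cnct_le.
rewrite mulrC ler_pdivrMr ?ltr0n // mulrC -ler_pdivrMr //.
by rewrite (le_trans hK) // ler_nat; lia.
Qed.

(** * Two-block connected sums and transport relations *)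

Local Open Scope ereal_scope.

Definition csum f g F : \bar R := \esum_(a in [set: nat]) \esum_(b in [set: nat])
  (cnct a b * f a * g b * F (a + b)%N)%:E.

Local Notation nonneg f := (forall m, 0 <= f m)%R.

Lemma csum_term_ge0 f g F a b : nonneg f -> nonneg g -> nonneg F ->
  0 <= (cnct a b * f a * g b * F (a + b)%N)%:E.
Proof. by move=> f0 g0 F0; rewrite lee_fin !mulr_ge0 // cnct_ge0. Qed.

Lemma csum_ge0 f g F : nonneg f -> nonneg g -> nonneg F -> 0 <= csum f g F.
Proof.
move=> f0 g0 F0; apply: esum_ge0 => a _; apply: esum_ge0 => b _.
exact: csum_term_ge0.
Qed.

Lemma csumC f g F : nonneg f -> nonneg g -> nonneg F -> csum f g F = csum g f F.
Proof.
move=> f0 g0 F0; rewrite /csum esumT_exchange; last first.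
  by move=> a b; exact: csum_term_ge0.
apply: eq_esum => b _; apply: eq_esum => a _.
by rewrite [cnct a b]cnctC [(a + b)%N]addnC; congr EFin; ring.
Qed.

(** Since [f] vanishes at [0], only [a + b > 0] matters. This allows [M * Scoef (1 :: l) M] to be
    replaced by [psum (Scoef l) M], which may differ at [M = 0]. *)
Lemma eq_csum f g F F' : f 0%N = 0%R -> (forall M, F M.+1 = F' M.+1) ->
  csum f g F = csum f g F'.
Proof.
move=> f0 FF'; apply: eq_esum => a _; apply: eq_esum => b _.
case: a => [|a]; first by rewrite f0 !(mulr0, mul0r).
by rewrite addSn FF'.
Qed.

Lemma csum_conv f g F : nonneg f -> nonneg g -> nonneg F ->
  csum f g F = \esum_(M in [set: nat]) (conv f g M * F M)%:E.
Proof.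
move=> f0 g0 F0; rewrite /csum
  (esum_antidiagonal (a := fun a b => (cnct a b * f a * g b * F (a + b)%N)%R)).
  apply: eq_esum => M _; rewrite /conv mulr_suml; congr EFin.
  by apply: eq_bigr => a _; rewrite subnKC // -ltnS.
by move=> a b; rewrite -lee_fin; exact: csum_term_ge0.
Qed.

Lemma csumDl f f' g F : nonneg f -> nonneg f' -> nonneg g -> nonneg F ->
  csum (f \+ f')%R g F = csum f g F + csum f' g F.
Proof.
move=> f0 f'0 g0 F0; rewrite /csum -esumD; try by
  move=> a _; apply: esum_ge0 => b _; exact: csum_term_ge0.
apply: eq_esum => a _; rewrite -esumD; try by
  move=> b _; exact: csum_term_ge0.
by apply: eq_esum => b _; rewrite -EFinD /= mulrDr !mulrDl.
Qed.

Lemma csum0l g F : csum (fun=> 0%R) g F = 0.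
Proof.
by rewrite /csum esum1 // => a _; rewrite esum1 // => b _; rewrite mulr0 !mul0r.
Qed.

Lemma csum0r f g F : f 0%N = 0%R -> (forall M, F M.+1 = 0%R) -> csum f g F = 0.
Proof.
move=> f0 F0; rewrite /csum esum1 // => a _; rewrite esum1 // => b _.
case: a => [|a]; first by rewrite f0 !(mulr0, mul0r).
by rewrite addSn F0 mulr0.
Qed.

(** This is [transport_row] weighted by [f a] and summed over [a]; the factor [1 / a] turns [f] into
    [dpow 1 f]. An entry [1] leaves the second word and raises the last exponent of the first. With
    [F = Scoef l], the correction term is the sum for [l] in place of [1 :: l]. *)
Lemma transport f g F : f 0%N = 0%R -> nonneg f -> nonneg g -> nonneg F ->
  csum f (dpow 1 (geo 1 g)) (psum F) =
  csum (dpow 1 f) g (psum F) +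
  csum (dpow 1 f) (dpow 1 (geo 1 g)) (fun M => M%:R * F M)%R.
Proof.
move=> f00 f0 g0 F0.
have dg0 m : (0 <= dpow 1 (geo 1 g) m)%R.
  by apply: dpow_ge0 => ?; exact: geo_ge0.
have df0 m : (0 <= dpow 1 f m)%R by exact: dpow_ge0.
have pF0 m : (0 <= psum F m)%R by exact: psum_ge0.
have MF0 m : (0 <= m%:R * F m)%R by rewrite mulr_ge0.
rewrite /csum -esumD; [|move=> a _; apply: esum_ge0 => b _..].
apply: eq_esum => -[|a] _.
  rewrite [LHS]esum1; last by move=> b _; rewrite f00 !(mulr0, mul0r).
  rewrite !esum1 ?adde0 // => b _; by rewrite dpow_at0 // !(mulr0, mul0r).
transitivity ((f a.+1)%:E * \esum_(b in [set: nat])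
   (cnct a.+1 b * dpow 1 (geo 1 g) b * psum F (a.+1 + b))%:E).
  rewrite -esumZl //; last first.
    by move=> b; rewrite lee_fin (mulr_ge0 (mulr_ge0 (cnct_ge0 _ _) (dg0 _))).
  by apply: eq_esum => b _; rewrite -EFinM; congr EFin; ring.
have r1 b : 0 <= (a.+1%:R^-1 * (cnct a.+1 b * g b * psum F (a.+1 + b)))%:E.
  by rewrite lee_fin mulr_ge0 ?invr_ge0 // (mulr_ge0 (mulr_ge0 (cnct_ge0 _ _) _)).
have r2 b : 0 <= (a.+1%:R^-1 * (cnct a.+1 b * dpow 1 (geo 1 g) b *
    ((a.+1 + b)%:R * F (a.+1 + b)%N)))%:E.
  rewrite lee_fin mulr_ge0 ?invr_ge0 //.
  exact: mulr_ge0 (mulr_ge0 (cnct_ge0 _ _) (dg0 _)) (MF0 _).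
rewrite transport_row // ge0_muleDr ?esum_ge0 // -!esumZl //.
by congr (_ + _); apply: eq_esum => b _; rewrite -EFinM; congr EFin;
   rewrite [dpow 1 f _]/dpow expr1; ring.
- exact: (csum_term_ge0 _ _ df0 g0 pF0).
- exact: (csum_term_ge0 (F := fun M => M%:R * F M)%R _ _ df0 dg0 MF0).
Qed.

Lemma transport_sym f g F : g 0%N = 0%R -> nonneg f -> nonneg g -> nonneg F ->
  csum (dpow 1 (geo 1 f)) g (psum F) =
  csum f (dpow 1 g) (psum F) +
  csum (dpow 1 (geo 1 f)) (dpow 1 g) (fun M => M%:R * F M)%R.
Proof.
move=> g00 f0 g0 F0.
have df0 m : (0 <= dpow 1 (geo 1 f) m)%R.
  by apply: dpow_ge0 => ?; exact: geo_ge0.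
have dg0 m : (0 <= dpow 1 g m)%R by exact: dpow_ge0.
have pF0 m : (0 <= psum F m)%R by exact: psum_ge0.
have MF0 m : (0 <= m%:R * F m)%R by rewrite mulr_ge0.
rewrite csumC // transport //; congr (_ + _); exact: csumC.
Qed.

(** * Integral span of polylogarithm values *)

Inductive Lspan p w : R -> Prop :=
| Lspan0 : Lspan p w 0%R
| Lspan_in s x : mpl_word p w s -> (1 < (head (0, 0) s).1)%N ->
    \esum_(M in [set: nat]) (Lcoef s M)%:E = x%:E -> Lspan p w x
| LspanB x y : Lspan p w x -> Lspan p w y -> Lspan p w (x - y)%R.

(** Finiteness and membership are bundled, so that convergence is obtained together with the
    evaluation. *)
Definition eLspan p w (e : \bar R) := exists2 x, e = x%:E & Lspan p w x.

Lemma LspanD p w x y : Lspan p w x -> Lspan p w y -> Lspan p w (x + y)%R.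
Proof.
move=> hx hy; rewrite -[y]opprK -[(- y)%R]sub0r; apply: LspanB => //.
exact/LspanB/hy/Lspan0.
Qed.

Lemma eLspan0 p w : eLspan p w 0.
Proof. by exists 0%R => //; exact: Lspan0. Qed.

Lemma eLspanD p w (e e' : \bar R) :
  eLspan p w e -> eLspan p w e' -> eLspan p w (e + e').
Proof. by case=> x -> hx [y -> hy]; exists (x + y)%R => //; exact: LspanD. Qed.

Lemma eLspan_sub p w (e e' : \bar R) : 0 <= e ->
  eLspan p w (e + e') -> eLspan p w e' -> eLspan p w e.
Proof.
move=> e0 [x ex hx] [y e'y hy]; move: e0 ex; rewrite e'y.
case: e => [r| |] // _ [rx]; exists r => //.
by rewrite (_ : r = x - y)%R; [exact: LspanB|rewrite -rx addrK].
Qed.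

(** The functional [phi] takes extended values and is additive only on nonnegative sequences,
    whereas [zspan] is built with differences. Hence [f] is exhibited as [f1 - f2] with both parts
    nonnegative and of finite value. *)
Lemma zspan_eLspan p w p' w' (phi : (nat -> R) -> \bar R) f :
    phi (fun=> 0%R) = 0 ->
    (forall g h, nonneg g -> nonneg h -> phi (g \+ h)%R = phi g + phi h) ->
    (forall g, nonneg g -> 0 <= phi g) ->
    (forall s, mpl_word p w s -> eLspan p' w' (phi (Lcoef s))) ->
  zspan p w f -> nonneg f -> eLspan p' w' (phi f).
Proof.
move=> phi0 phiD phi_ge0 phiL hf f0.
suff [f1 [f2 [f10 f20 g1 g2 ff]]] : exists f1 f2, [/\ nonneg f1, nonneg f2,
    eLspan p' w' (phi f1), eLspan p' w' (phi f2) & (f \+ f2 = f1)%R].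
  apply: (@eLspan_sub _ _ _ (phi f2)) => //; first exact: phi_ge0.
  by rewrite -phiD // ff.
elim: hf {f0} => [|s vs|g h _ [g1 [g2 [g10 g20 gg1 gg2 gE]]] _
                             [h1 [h2 [h10 h20 hh1 hh2 hE]]]].
- exists (fun=> 0%R), (fun=> 0%R); rewrite phi0; split=> //; try exact: eLspan0.
  by apply/funext => M /=; rewrite addr0.
- exists (Lcoef s), (fun=> 0%R); rewrite phi0; split=> //.
  + exact: Lcoef_ge0.
  + exact: phiL.
  + exact: eLspan0.
  + by apply/funext => M /=; rewrite addr0.
- exists (g1 \+ h2)%R, (g2 \+ h1)%R; split.
  + by move=> m /=; rewrite addr_ge0.
  + by move=> m /=; rewrite addr_ge0.
  + by rewrite phiD //; exact: eLspanD.
  + by rewrite phiD //; exact: eLspanD.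
  + by rewrite -gE -hE; apply/funext => M /=; ring.
Qed.

(** * Convergence of admissible polylogarithm series *)

Lemma esum_le_bound (u : nat -> R) (B : \bar R) :
    nonneg u -> (forall N, (\sum_(m < N) u m)%:E <= B) ->
  \esum_(m in [set: nat]) (u m)%:E <= B.
Proof.
move=> u0 uB; rewrite -nneseries_esumT; last by move=> n; rewrite lee_fin.
apply: lime_le; first by apply: is_cvg_nneseries => n _ _; rewrite lee_fin.
by apply: nearW => N; rewrite big_mkord sumEFin.
Qed.

Lemma sum_le_esum (u : nat -> R) N : nonneg u ->
  (\sum_(m < N) u m)%:E <= \esum_(m in [set: nat]) (u m)%:E.
Proof.
move=> u0; rewrite -nneseries_esumT; last by move=> n; rewrite lee_fin.
rewrite -sumEFin -(big_mkord xpredT (fun m => (u m)%:E)).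
by apply: nneseries_lim_ge => n _ _; rewrite lee_fin.
Qed.

(* Since [\sum_(M > m) 1 / M ^ 2 <= 1 / m], an outer summation variable can be
   dropped without increasing the exponent of the next one. *)
Lemma partial_dpow2_geo1 f N : nonneg f ->
  (\sum_(M < N.+2) dpow 2 (geo 1 f) M + N.+1%:R^-1 * geo 1 f N.+2 <=
   2 * f 0%N + \sum_(M < N.+2) dpow 1 f M)%R.
Proof.
move=> f0; elim: N => [|N IHN].
  rewrite !big_ord_recl !big_ord0 /= !dpow_at0 // /dpow !geo1S geo0.
  rewrite /= !expr1 expr1n invr1 !mul1r /bump /=.
  lra.
rewrite big_ord_recr [in leRHS]big_ord_recr /= [in leRHS]addrA.
move: IHN; set A := (\sum_(i < _) _)%R; set B := (\sum_(i < _) _)%R.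
rewrite [geo 1 f N.+3]geo1S /dpow expr1; set G := geo 1 f N.+2.
have G0 : (0 <= G)%R by exact: geo_ge0.
have x0 : (0 < N.+1%:R :> R)%R by rewrite ltr0n.
have hx : (N.+2%:R = N.+1%:R + 1 :> R)%R by rewrite natr1.
have key : ((N.+2%:R ^+ 2)^-1 + N.+2%:R^-1 <= N.+1%:R^-1 :> R)%R.
  rewrite hx; move: (N.+1%:R : R)%R x0 => x x0.
  rewrite -subr_ge0 (_ : _ - _ = (x * (x + 1) ^+ 2)^-1)%R.
    by rewrite invr_ge0 mulr_ge0 ?exprn_ge0 ?addr_ge0 ?ltW.
  by field; rewrite !gt_eqF ?addr_gt0.
have {}key := ler_wpM2r G0 key.
move: key; rewrite mulrDl; move: (f N.+2) => z.
rewrite mulrDr; move: (N.+2%:R ^- 2 * G)%R (N.+2%:R^-1 * G)%R (N.+1%:R^-1 * G)%R.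
by move: (N.+2%:R^-1 * z)%R => *; lra.
Qed.

Lemma geo_le1 j f M : (0 < j)%N -> nonneg f -> (geo j f M <= geo 1 f M)%R.
Proof.
move=> j0 f0; apply: ler_sum => m _; rewrite ler_wpM2r //.
rewrite invr1 expr1n exprn_ile1 // ?invr_ge0 // invf_le1 ?ler1n //.
by rewrite ltr0n.
Qed.

(** The worst case is [e = j = 1], which [partial_dpow2_geo1] bounds. *)
Lemma esum_dpow_geo e j f : (0 < e)%N -> (0 < j)%N -> nonneg f ->
  \esum_(M in [set: nat]) (dpow 1 f M)%:E < +oo ->
  \esum_(M in [set: nat]) (dpow 1 (dpow e (geo j f)) M)%:E < +oo.
Proof.
move=> e0 j0 f0 foo.
have d0 m : (0 <= dpow 1 f m)%R by exact: dpow_ge0.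
have dg0 m : (0 <= dpow 2 (geo 1 f) m)%R.
  by apply: dpow_ge0 => ?; exact: geo_ge0.
apply: (@le_lt_trans _ _ (\esum_(M in [set: nat]) (dpow 2 (geo 1 f) M)%:E)).
  apply: le_esum => M _; rewrite lee_fin dpow_add /dpow.
  case: M => [|M]; first by rewrite !geo0 !mulr0.
  rewrite ler_pM ?invr_ge0 ?exprn_ge0 ?geo_ge0 ?geo_le1 //.
  rewrite lef_pV2 ?posrE ?exprn_gt0 ?ltr0n //.
  by rewrite ler_weXn2l ?ler1n //; lia.
apply: (@le_lt_trans _ _ ((2 * f 0%N)%:E + \esum_(M in [set: nat]) (dpow 1 f M)%:E)).
  apply: esum_le_bound => // N.
  apply: (@le_trans _ _ (2 * f 0%N + \sum_(M < N.+2) dpow 1 f M)%:E).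
    rewrite lee_fin (le_trans _ (partial_dpow2_geo1 N f0)) //.
    rewrite !big_ord_recr /= -!addrA lerDl !addr_ge0 //.
    by rewrite mulr_ge0 ?invr_ge0 ?geo_ge0.
  by rewrite EFinD leeD2l // sum_le_esum.
by rewrite lte_add_pinfty // ltry.
Qed.

(** The extra division by [M] brings the last exponent to at least [2]. Convergence is inherited
    from the shorter word. *)
Lemma esum_dpow_Lcoef p w s : mpl_word p w s ->
  \esum_(M in [set: nat]) (dpow 1 (Lcoef s) M : R)%:E < +oo.
Proof.
case/and4P => _ + _ _; elim: s => [_|[e j] s IHs /= /andP[/and3P[e0 j0 _]] hs].
  rewrite esum1 ?ltry // => -[|M] _; first by rewrite dpow_at0.
  by rewrite /dpow /= mulr0.
by apply: esum_dpow_geo => //; [exact: Lcoef_ge0|exact: IHs].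
Qed.

Lemma eLspan_dpow_Lcoef p w s : mpl_word p w s ->
  eLspan p w.+1 (\esum_(M in [set: nat]) (dpow 1 (Lcoef s) M)%:E).
Proof.
move=> vs; have foo := esum_dpow_Lcoef vs.
have f0 : 0 <= \esum_(M in [set: nat]) (dpow 1 (Lcoef s) M : R)%:E.
  by apply: esum_ge0 => M _; rewrite lee_fin dpow_ge0 // => m; exact: Lcoef_ge0.
case E : (esum _ _) f0 foo => [x||] // _ _; exists x => //.
case: s vs E => [//|[e j] s] vs E; have [/andP[e0 _] jp _] := mpl_word_cons vs.
apply: (@Lspan_in _ _ ((e.+1, j) :: s)) => //.
  case/and4P: vs => _ /= /andP[_ sall] slast /eqP sw.
  apply/and4P; split=> //=; first by rewrite jp.
    by case: (s) slast.
  by rewrite addSn sw.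
by rewrite -E; apply: eq_esum => M _; rewrite Lcoef_pred.
Qed.

Lemma eLspan_esum_dpow p w f : zspan p w f -> nonneg f ->
  eLspan p w.+1 (\esum_(M in [set: nat]) (dpow 1 f M)%:E).
Proof.
apply: (zspan_eLspan (phi := fun f => \esum_(M in [set: nat]) (dpow 1 f M)%:E)).
- by rewrite esum1 // => M _; rewrite /dpow mulr0.
- move=> g h g0 h0; rewrite -esumD; try by move=> M _; rewrite lee_fin dpow_ge0.
  by apply: eq_esum => M _; rewrite /dpow mulrDr.
- by move=> g g0; apply: esum_ge0 => M _; rewrite lee_fin dpow_ge0.
- by move=> s; exact: eLspan_dpow_Lcoef.
Qed.

End ConnectedSums.

(** * Evaluation of two-block connected sums *)

Section Evaluation.
Context {R : realType}.
Implicit Types (f g h F : nat -> R) (a b c d e i j m M p q w v : nat).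
Local Open Scope ereal_scope.

Local Notation nonneg f := (forall m, 0 <= f m)%R.

Lemma mpl_word_raise p w c j s :
  mpl_word p w ((c, j) :: s) -> mpl_word p w.+1 ((c.+1, j) :: s).
Proof.
case/and4P => _ /= /andP[/andP[_ jp] sall] slast /eqP sw.
apply/and4P; split=> //=; first by rewrite jp.
  by case: (s) slast.
by rewrite addSn sw.
Qed.

Lemma mpl_word_snoc1 p w s : mpl_word p w s -> mpl_word p w.+1 ((1, 1)%N :: s).
Proof.
case: s => [//|[c j] s] vs.
have [_ /andP[j0 jp] _] := mpl_word_cons vs.
case/and4P: vs => _ sall slast /eqP sw; apply/and4P; split=> //.
  by rewrite [all _ _]/= -/(all _ _) (leq_trans j0 jp).
by rewrite -sw.
Qed.

(** Of the exponent [c + 2], one unit cancels the factor [M], [c] units act by [dpow c] on the span,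
    and the last one ensures convergence. *)
Lemma eLspan_csum_ge2 p w q v s t c l : mpl_word p w s -> mpl_word q v t ->
    all (leq 1) l ->
  eLspan (p + q) (w + v + c.+1 + sumn l)
    (csum (Lcoef s) (Lcoef t) (fun M => M%:R * Scoef (c.+2 :: l) M : R)%R).
Proof.
move=> vs vt lpos.
have s0 := @Lcoef_ge0 R s; have t0 := @Lcoef_ge0 R t.
have S0 := @Scoef_ge0 R.
have P0 m : (0 <= psum (Scoef l) m :> R)%R by exact: psum_ge0.
have c0 m : (0 <= conv (Lcoef s) (Lcoef t) m :> R)%R by exact: conv_ge0.
rewrite csum_conv //; last by move=> m; rewrite mulr_ge0.
have := zspan_dpow c (zspan_mul_psum (zspan_conv_in (R := R) vs vt) lpos).
move/eLspan_esum_dpow.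
rewrite (_ : (w + v + sumn l + c).+1 = w + v + c.+1 + sumn l)%N; last by lia.
rewrite (_ : (fun M => _) = (fun M => (conv (Lcoef s) (Lcoef t) M *
    (M%:R * Scoef (c.+2 :: l) M))%:E)) //.
  by apply=> m; apply: dpow_ge0 => M; rewrite mulr_ge0.
apply/funext => -[|M]; first by rewrite dpow_at0 // mul0r mulr0.
rewrite /= /dpow expr1 (exprS _ c.+1) exprS !invfM; congr EFin.
have x0 : (M.+1%:R != 0 :> R)%R by rewrite pnatr_eq0.
move: (M.+1%:R : R)%R (divff x0) => x xx.
move: (conv _ _ _) (psum _ _) ((x ^+ c)^-1)%R => u z r.
transitivity (u * ((x * x^-1) * (x^-1 * r * z)))%R; last by ring.
by rewrite xx; ring.
Qed.

(** Base case of the transport: the second word is used up, and [Lcoef [::]] is neutral for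
    [conv]. *)
Lemma eLspan_csum_nil p w s l : mpl_word p w s -> all (leq 1) l ->
  eLspan p (w + sumn l).+1
    (csum (dpow 1 (Lcoef s)) (Lcoef [::]) (psum (Scoef l) : nat -> R)).
Proof.
move=> vs lpos.
have s0 := @Lcoef_ge0 R s.
have P0 m : (0 <= psum (Scoef l) m :> R)%R.
  by apply: psum_ge0 => ?; exact: Scoef_ge0.
rewrite csum_conv //; last by move=> m; exact: dpow_ge0.
rewrite conv_unit; have := eLspan_esum_dpow (zspan_star (R := R) vs lpos).
rewrite (_ : (fun M => _) = (fun M =>
  (dpow 1 (Lcoef s) M * psum (Scoef l) M)%:E)); last first.
  by apply/funext => M; rewrite /dpow mulrA.
by apply=> m; rewrite mulr_ge0.
Qed.

(* An induction on [v + sumn l]; [transport_sym] is read from right to left, which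
   is why a difference of (finite) sums occurs. *)
Lemma eLspan_csum p w s v t l : mpl_word p w s -> mpl_word 1 v t ->
    l != [::] -> all (leq 1) l ->
  eLspan p.+1 (w + v + sumn l).-1
    (csum (Lcoef s) (Lcoef t) (fun M => M%:R * Scoef l M : R)%R).
Proof.
have [N] := ubnP (v + sumn l).
elim: N w s v t l => // N IHN w s v t [//|c l] /= vl vs vt _ /andP[c0 lpos].
case: c c0 vl => [//|[|c]] _ vl; last first.
  rewrite (_ : (w + v + (c.+2 + sumn l)).-1 = w + v + c.+1 + sumn l)%N; last by lia.
  by rewrite -addn1; exact: eLspan_csum_ge2.
case: s vs => [//|[e i] s] vs; case: t vt => [//|[d j] t] vt.
have ss0 : Lcoef ((e, i) :: s) 0 = 0%R :> R by exact: Lcoef_cons0.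
have SE M : (M.+1%:R * Scoef (1%N :: l) M.+1 = psum (Scoef l) M.+1 :> R)%R.
  by rewrite /= /dpow expr1 mulrA divff ?mul1r // pnatr_eq0.
rewrite (eq_csum _ ss0 SE).
have [/andP[d0 dv] /andP[j0 j1] vt'] := mpl_word_cons vt.
(* The bound [1] forces the argument [1] in [t], as the transport relation requires. *)
have {j0 j1} jE : j = 1%N by apply/eqP; rewrite eqn_leq j1.
rewrite jE in vt *.
have L0 := @Lcoef_ge0 R; have S0 := @Scoef_ge0 R l.
have IHl w' s' v' t' : (v' + sumn l < N)%N -> mpl_word p w' s' -> mpl_word 1 v' t' ->
    eLspan p.+1 (w' + v' + sumn l).-1
      (csum (Lcoef s') (Lcoef t') (fun M => M%:R * Scoef l M : R)%R).
  (* If [l] has become empty, [M * (M == 0)] vanishes identically and the sum is zero. *)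
  move=> vl' vs' vt''; case: l lpos vl' {vl SE S0} => [|c l] lpos vl'.
    rewrite csum0r //; first exact: eLspan0.
      by case: s' vs' => [//|x s'] _; exact: Lcoef_cons0.
    by move=> M; rewrite mulr0.
  exact: IHN.
rewrite (_ : (w + v + (1 + sumn l)).-1 = (w + v + sumn l)%N); last by lia.
case: d d0 dv vt vt' => [//|[|d]] _ dv vt vt'.
  rewrite [Lcoef ((1, 1)%N :: t)]/= transport // -?Lcoef_pred.
  apply: eLspanD.
    case: vt' => [[-> [-> _]]|vt'].
      rewrite (_ : (w + 1 + sumn l = (w + sumn l).+1)%N); last by lia.
      by rewrite Lcoef_pred; apply: eLspan_csum_nil => //; exact: mpl_word_mono vs.
    have h : Lcoef ((e.+1, i) :: s) 0 = 0%R :> R by exact: Lcoef_cons0.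
    rewrite -(@eq_csum _ _ _ (fun M => M%:R * Scoef (1%N :: l) M)%R _ h SE).
    have := IHN w.+1 ((e.+1, i) :: s) (v - 1)%N t (1%N :: l).
    rewrite (_ : (w.+1 + (v - 1) + sumn (1%N :: l)).-1 =
      (w + v + sumn l)%N) /=; last by lia.
    by apply=> //; [lia|exact: mpl_word_raise].
  have := IHl w.+1 ((e.+1, i) :: s) v ((1, 1)%N :: t).
  rewrite (_ : (w.+1 + v + sumn l).-1 = (w + v + sumn l)%N); last by lia.
  by apply=> //; [lia|exact: mpl_word_raise].
have L0' : Lcoef ((d.+1, 1)%N :: t) 0 = 0%R :> R by exact: Lcoef_cons0.
(* The last exponent [d + 2] of [t] drops to [d + 1] while the first word gains an entry [1]; the
   subtracted term keeps [d + 2] but has lost the final [1] of [l]. Both decrease the measure. *)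
have := transport_sym L0' (L0 ((e, i) :: s)) (L0 _) S0.
rewrite -[dpow 1 (geo 1 (Lcoef ((e, i) :: s)))]/(Lcoef ((1, 1)%N :: (e, i) :: s)).
rewrite -!Lcoef_pred => E.
have := IHl w.+1 [:: (1, 1)%N, (e, i) & s] v ((d.+2, 1)%N :: t).
rewrite (_ : (w.+1 + v + sumn l).-1 = (w + v + sumn l)%N); last by lia.
move=> h2; apply: eLspan_sub (h2 _ _ _).
- apply: csum_ge0 => //; by move=> m; exact: psum_ge0.
- rewrite -E.
  have h : Lcoef [:: (1, 1)%N, (e, i) & s] 0 = 0%R :> R by exact: Lcoef_cons0.
  rewrite -(@eq_csum _ _ _ (fun M => M%:R * Scoef (1%N :: l) M)%R _ h SE).
  have := IHN w.+1 [:: (1, 1)%N, (e, i) & s] v.-1 ((d.+1, 1)%N :: t) (1%N :: l).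
  rewrite (_ : (w.+1 + v.-1 + sumn (1%N :: l)).-1 =
    (w + v + sumn l)%N) /=; last by lia.
  by apply=> //; [lia|exact: mpl_word_snoc1|exact: mpl_word_pred].
- by lia.
- exact: mpl_word_snoc1.
- exact: vt.
Qed.

(** Linearity in the first factor lets it be a convolution of several blocks, not only a word. *)
Lemma eLspan_csum_zspan p w f v t l : zspan p w f -> nonneg f -> mpl_word 1 v t ->
    l != [::] -> all (leq 1) l ->
  eLspan p.+1 (w + v + sumn l).-1
    (csum f (Lcoef t) (fun M => M%:R * Scoef l M : R)%R).
Proof.
move=> hf f0 vt lN0 lpos.
have t0 := @Lcoef_ge0 R t.
have S0 m : (0 <= m%:R * Scoef l m :> R)%R.
  by rewrite mulr_ge0 //; exact: Scoef_ge0.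
move: hf f0; apply: (zspan_eLspan (phi := fun f =>
  csum f (Lcoef t) (fun M => M%:R * Scoef l M : R)%R)).
- exact: csum0l.
- by move=> g h g0 h0; rewrite csumDl.
- by move=> g g0; exact: csum_ge0.
- by move=> s vs; exact: eLspan_csum.
Qed.

End Evaluation.

(** * Nested sums with general kernels *)

Section KernelSums.
Context {R : realType}.
Implicit Types (f g h F : nat -> R) (a b c M : nat).
Implicit Types (K : seq (nat -> nat -> R)).

(** Chains are read from the largest variable down, and the default of [head] supplies [m_0 = 0].
    Length mismatches give [0], so sums may range over all sequences. Strict and weak chains are
    treated alike. *)
Fixpoint kweight K (m : seq nat) : R :=
  match K, m with
  | [::], [::] => 1
  | k :: K', M :: m' => k (head 0%N m') M * kweight K' m'
  | _, _ => 0
  end.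

Fixpoint kcoef K : nat -> R :=
  if K is k :: K' then fun M => \sum_(a < M.+1) k a M * kcoef K' a
  else fun M => (M == 0%N)%:R.

Definition kernel_ok (k : nat -> nat -> R) :=
  (forall a M, 0 <= k a M) /\ (forall a M, (M < a)%N -> k a M = 0).

Lemma kweight_ge0 K (m : seq nat) : (forall k, List.In k K -> kernel_ok k) ->
  0 <= kweight K m.
Proof.
elim: K m => [|k K IHK] [|M m] //= Kok; rewrite mulr_ge0 //.
  by case: (Kok k (or_introl erefl)).
by apply: IHK => k' Kk'; apply: Kok; right.
Qed.

Local Open Scope ereal_scope.

Lemma esum_seq (T : choiceType) (f : seq T -> \bar R) : (forall m, 0 <= f m) ->
  \esum_(m in [set: seq T]) f m = f [::] +
  \esum_(x in [set: T]) \esum_(m in [set: seq T]) f (x :: m).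
Proof.
move=> f0; rewrite (esumID [set [::]]) // setTI esum_set1 //; congr (_ + _).
rewrite esumT_pair //; apply: reindex_esum; split=> /=.
- by move=> [x m] _.
- by move=> [x m] [y m'] _ _ /= [-> ->].
- by move=> [|x m] [_ /= mN0] //; exists (x, m).
Qed.

Lemma esum_finite_support f N : (forall m, 0 <= f m)%R ->
    (forall m, (N <= m)%N -> f m = 0%R) ->
  \esum_(m in [set: nat]) (f m)%:E = (\sum_(m < N) f m)%:E.
Proof.
move=> f0 fN; rewrite (esumID `I_N) ?setTI; last by move=> *; rewrite lee_fin.
rewrite [X in _ + X]esum1 ?adde0; last first.
  by move=> m /negP /=; rewrite -leqNgt => /fN ->.
rewrite esum_fset //; last by move=> *; rewrite lee_fin.
by rewrite -fsbig_ord -sumEFin.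
Qed.

Lemma esum_kweight_rev K f : (forall k, List.In k K -> kernel_ok k) ->
    (forall m, 0 <= f m)%R ->
  \esum_(m in [set: seq nat]) (kweight K m * f (head 0%N m))%:E =
  \esum_(M in [set: nat]) (kcoef K M * f M)%:E.
Proof.
elim: K f => [|k K IHK] f Kok f0.
  rewrite esum_seq; last first.
    by move=> [|x m]; rewrite lee_fin mulr_ge0.
  rewrite esum1 => [|x _]; last by rewrite esum1 // => m _; rewrite /= mul0r.
  rewrite (esum_finite_support (N := 1)) => [|m|[|m]] //=.
  - by rewrite adde0 big_ord1.
  - by rewrite mulr_ge0.
  - by rewrite mul0r.
have [k0 kz] := Kok k (or_introl erefl).
have Kok' k' : List.In k' K -> kernel_ok k' by move=> ?; apply: Kok; right.
have W0 m : (0 <= kweight (k :: K) m)%R by exact: kweight_ge0.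
rewrite esum_seq; last by move=> m; rewrite lee_fin mulr_ge0.
rewrite [kweight _ [::]]/= mul0r add0e; apply: eq_esum => M _.
(* The outermost kernel is absorbed into the test function of the shorter list, hence the arbitrary
   [f] in the induction. *)
transitivity (\esum_(a in [set: nat]) (kcoef K a * (k a M * f M))%:E).
  rewrite -(IHK (fun a => k a M * f M)%R) // => [|m]; last by rewrite mulr_ge0.
  by apply: eq_esum => m _ /=; congr EFin; ring.
have C0 K' : (forall k', List.In k' K' -> kernel_ok k') ->
    forall a, (0 <= kcoef K' a)%R.
  elim: K' => [|k' K' IH] ok a //=; apply: sumr_ge0 => b _.
  rewrite mulr_ge0 ?IH //; first by case: (ok k' (or_introl erefl)).
  by move=> *; apply: ok; right.
rewrite (esum_finite_support (N := M.+1)) => [|a|a Ma].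
- by rewrite /= mulr_suml; congr EFin; apply: eq_bigr => a _; ring.
- by rewrite !mulr_ge0 ?C0.
- by rewrite kz // mul0r mulr0.
Qed.

Lemma esum_kweight K f : (forall k, List.In k K -> kernel_ok k) ->
    (forall m, 0 <= f m)%R ->
  \esum_(m in [set: seq nat]) (kweight K (rev m) * f (last 0%N m))%:E =
  \esum_(M in [set: nat]) (kcoef K M * f M)%:E.
Proof.
move=> Kok f0; rewrite -esum_kweight_rev //.
rewrite (reindex_esumT (e := @rev nat)); last by exists rev; exact: revK.
apply: eq_esum => m _; rewrite revK; congr (_ * f _)%:E.
by case: m => [//|x m]; rewrite rev_cons last_rcons.
Qed.

Local Close Scope ereal_scope.

(** The factor [(a < M)] is what makes the chain strict, since [M - a] is truncated. *)
Definition kerL (x : nat * nat) a M : R :=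
  (M%:R ^+ x.1)^-1 * ((a < M)%:R * x.2%:R^-1 ^+ (M - a)).

Definition kerS c a M : R := (M%:R ^+ c)^-1 * (a <= M)%:R.

Lemma kerL_ok x : kernel_ok (kerL x).
Proof.
split=> a M; first by rewrite /kerL !mulr_ge0 ?invr_ge0 ?exprn_ge0 ?invr_ge0.
by move=> Ma; rewrite /kerL ltnNge ltnW // mul0r mulr0.
Qed.

Lemma kerS_ok c : kernel_ok (kerS c).
Proof.
split=> a M; first by rewrite /kerS !mulr_ge0 ?invr_ge0 ?exprn_ge0.
by move=> Ma; rewrite /kerS leqNgt Ma mulr0.
Qed.

Lemma map_kernel_ok (T : Type) (ker : T -> nat -> nat -> R) (s : seq T) :
  (forall x, kernel_ok (ker x)) -> forall k, List.In k (map ker s) -> kernel_ok k.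
Proof. by move=> ok k; elim: s => [//|x s IHs] /= [<-|/IHs]. Qed.

Lemma kcoef_kerL s : kcoef (map kerL s) = Lcoef s.
Proof.
elim: s => [//|x s IHs]; apply/funext => M /=; rewrite IHs.
rewrite big_ord_recr /= {2}/kerL ltnn mul0r mulr0 mul0r addr0 /dpow /geo mulr_sumr.
by apply: eq_bigr => a _; rewrite /kerL ltn_ord mul1r mulrA.
Qed.

Lemma kcoef_kerS l : kcoef (map kerS l) = Scoef l.
Proof.
elim: l => [//|c l IHl]; apply/funext => M /=; rewrite IHl /dpow /psum mulr_sumr.
by apply: eq_bigr => a _; rewrite /kerS -ltnS ltn_ord mulr1.
Qed.

End KernelSums.

(** * Connected sums over families of blocks *)

Section ConnectedFamilies.
Context {R : realType}.
Implicit Types (a b c M : nat).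

Definition cnctn n (a : 'I_n -> nat) : R :=
  (\prod_(j < n) (a j)`!)%N%:R / ((\sum_(j < n) a j)%N`!)%:R.

Fixpoint convn n : ('I_n -> nat -> R) -> nat -> R :=
  if n is n'.+1 then fun f => conv (convn (fun j => f (lift ord_max j))) (f ord_max)
  else fun _ => Lcoef [::].

Lemma widen_lift n (j : 'I_n) : widen_ord (leqnSn n) j = lift ord_max j.
Proof. by apply/val_inj/esym; exact: lift_max. Qed.

(** The factorial of the partial sum cancels, so the connector of several blocks is an iterated
    binary one. *)
Lemma cnctn_recr n (a : 'I_n.+1 -> nat) :
  cnctn a = cnctn (fun j => a (lift ord_max j)) *
            cnct (\sum_(j < n) a (lift ord_max j)) (a ord_max).
Proof.
rewrite /cnctn /cnct !big_ord_recr /=.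
under eq_bigr do rewrite widen_lift.
under [in X in _ / X]eq_bigr do rewrite widen_lift.
move: (\prod_(i < n) _)%N (\sum_(i < n) _)%N => P S.
have S0 : S`!%:R != 0 :> R by rewrite pnatr_eq0 -lt0n fact_gt0.
have key (x y z t : R) : x != 0 -> y * z * t = y / x * (x * z * t).
  by move=> x0; field.
by rewrite !natrM; exact: key.
Qed.

Lemma cnctn_ge0 n (a : 'I_n -> nat) : 0 <= cnctn a.
Proof. by rewrite /cnctn mulr_ge0 // invr_ge0. Qed.

Lemma convn_ge0 n (f : 'I_n -> nat -> R) M : (forall j m, 0 <= f j m) ->
  0 <= convn f M.
Proof.
elim: n f M => [|n IHn] f M f0; first by rewrite Lcoef_ge0.
by apply: conv_ge0 => m; rewrite ?IHn.
Qed.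

(** Each block has denominators at most [1], and bounds add under convolution. *)
Lemma zspan_convn n (t : 'I_n.+1 -> seq (nat * nat)) (v : 'I_n.+1 -> nat) :
    (forall j, mpl_word 1 (v j) (t j)) ->
  zspan n.+1 (\sum_(j < n.+1) v j) (convn (fun j => Lcoef (t j)) : nat -> R).
Proof.
elim: n t v => [|n IHn] t v vt.
  rewrite big_ord1 /= convC conv_unit (_ : ord_max = ord0); last exact: val_inj.
  exact: zspan_in.
rewrite big_ord_recr; under eq_bigr do rewrite widen_lift.
have := IHn (fun j => t (lift ord_max j)) (fun j => v (lift ord_max j))
  (fun j => vt (lift ord_max j)).
by move/zspan_conv => /(_ _ _ _ (zspan_in (vt ord_max))); rewrite addn1.
Qed.

Local Open Scope ereal_scope.

Definition ffun_snoc (T : Type) n (x : {ffun 'I_n -> T} * T) : {ffun 'I_n.+1 -> T} :=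
  [ffun j => if unlift ord_max j is Some j' then x.1 j' else x.2].

Lemma ffun_snoc_bij (T : Type) n : bijective (@ffun_snoc T n).
Proof.
exists (fun m : {ffun 'I_n.+1 -> T} => ([ffun j => m (lift ord_max j)], m ord_max)).
  move=> [m x]; congr pair; last by rewrite ffunE /= unlift_none.
  by apply/ffunP => j; rewrite !ffunE /= liftK.
move=> m; apply/ffunP => j; rewrite !ffunE /=.
by case: unliftP => [j'|] -> /=; rewrite ?ffunE.
Qed.

Lemma esum_family n (t : 'I_n -> seq (nat * nat)) (F : nat -> R) :
    (forall m, 0 <= F m)%R ->
  \esum_(m in [set: {ffun 'I_n -> seq nat}])
    (\prod_(j < n) kweight (map kerL (t j)) (rev (m j)) *
     cnctn (fun j => last 0%N (m j)) *
     F (\sum_(j < n) last 0%N (m j))%N)%:E =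
  \esum_(M in [set: nat]) (convn (fun j => Lcoef (t j)) M * F M)%:E.
Proof.
have ok x : forall k, List.In k (map (@kerL R) x) -> kernel_ok k.
  by apply: map_kernel_ok; exact: kerL_ok.
have W0 x m : (0 <= kweight (map (@kerL R) x) m)%R by exact: kweight_ge0 (ok x).
elim: n t F => [|n IHn] t F F0.
  have -> : [set: {ffun 'I_0 -> seq nat}] = [set [ffun=> [::]]].
    by apply/seteqP; split=> // m _ /=; apply/ffunP => -[].
  rewrite esum_set1; last by rewrite lee_fin !mulr_ge0 ?cnctn_ge0 ?prodr_ge0.
  rewrite (esum_finite_support (N := 1)) => [|m|[|m]] //=.
  - by rewrite big_ord1 !big_ord0 /cnctn !big_ord0 fact0 divff ?oner_neq0 // mulr1.
  - by rewrite mulr_ge0.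
  - by rewrite mul0r.
rewrite (reindex_esumT _ (@ffun_snoc_bij (seq nat) n)).
pose tt j := t (lift ord_max j).
pose A (m : {ffun 'I_n -> seq nat}) (x : seq nat) :=
  (\prod_(j < n) kweight (map kerL (tt j)) (rev (m j)) *
   cnctn (fun j => last 0%N (m j)) *
   (cnct (\sum_(j < n) last 0%N (m j)) (last 0%N x) *
    kweight (map kerL (t ord_max)) (rev x) *
    F (\sum_(j < n) last 0%N (m j) + last 0%N x)%N) : R)%R.
have A0 m x : 0 <= (A m x)%:E.
  rewrite lee_fin /A; apply: mulr_ge0; first by rewrite mulr_ge0 ?prodr_ge0 ?cnctn_ge0.
  by rewrite !mulr_ge0 // cnct_ge0.
transitivity (\esum_(m in [set: {ffun 'I_n -> seq nat}])
              \esum_(x in [set: seq nat]) (A m x)%:E).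
  rewrite esumT_pair //; apply: eq_esum => -[m x] _; congr EFin.
  have sE j : ffun_snoc (m, x) (lift ord_max j) = m j by rewrite ffunE liftK.
  have sM : ffun_snoc (m, x) ord_max = x by rewrite ffunE unlift_none.
  rewrite cnctn_recr !big_ord_recr /= sM.
  have -> : cnctn (fun j => last 0%N (ffun_snoc (m, x) (lift ord_max j))) =
      cnctn (fun j => last 0%N (m j)) :> R.
    by congr cnctn; apply/funext => j; rewrite sE.
  have -> : (\sum_(j < n) last 0 (ffun_snoc (m, x) (lift ord_max j)) =
      \sum_(j < n) last 0 (m j))%N by apply: eq_bigr => j _; rewrite sE.
  have -> : (\sum_(j < n) last 0 (ffun_snoc (m, x) (widen_ord (leqnSn n) j)) =
      \sum_(j < n) last 0 (m j))%N.
    by apply: eq_bigr => j _; rewrite widen_lift sE.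
  rewrite [X in (X * _ * _ * _)%R](_ : _ =
      \prod_(j < n) kweight (map kerL (tt j)) (rev (m j)))%R; last first.
    by apply: eq_bigr => j _; rewrite widen_lift sE.
  by rewrite /A /tt /=; ring.
rewrite esumT_exchange //.
transitivity (\esum_(x in [set: seq nat]) \esum_(a in [set: nat])
   (convn (fun j => Lcoef (tt j)) a * (cnct a (last 0%N x) *
     kweight (map kerL (t ord_max)) (rev x) * F (a + last 0%N x)%N))%:E).
  apply: eq_esum => x _.
  (* With the last chain [x] fixed, its weight and the binary connector are part of the function of
     the remaining sum [a]. *)
  rewrite -(IHn _ (fun a => cnct a (last 0%N x) *
     kweight (map kerL (t ord_max)) (rev x) * F (a + last 0%N x)%N)%R) //.
  by move=> m; rewrite !mulr_ge0 // cnct_ge0.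
have H0 a : (0 <= convn (fun j => Lcoef (tt j)) a :> R)%R.
  by apply: convn_ge0 => *; exact: Lcoef_ge0.
rewrite esumT_exchange; last first.
  by move=> x a; rewrite lee_fin mulr_ge0 // !mulr_ge0 // cnct_ge0.
transitivity (csum (convn (fun j => Lcoef (tt j))) (Lcoef (t ord_max)) F); last first.
  by rewrite csum_conv // => m; exact: Lcoef_ge0.
apply: eq_esum => a _.
transitivity (\esum_(b in [set: nat]) (kcoef (map kerL (t ord_max)) b *
    (cnct a b * convn (fun j => Lcoef (tt j)) a * F (a + b)%N))%:E).
  rewrite -(esum_kweight (ok (t ord_max)) (f := fun b =>
    cnct a b * convn (fun j => Lcoef (tt j)) a * F (a + b)%N)%R) //.
    by apply: eq_esum => x _; congr EFin; ring.
  by move=> b; rewrite !mulr_ge0 // cnct_ge0.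
by rewrite kcoef_kerL; apply: eq_esum => b _; congr EFin; ring.
Qed.

End ConnectedFamilies.

(** * From extended real sums to complex series *)

Section Bridge.
Context {R : realType}.

Local Notation toC := (real_complex R).

Lemma partial_sumE (I : choiceType) (f : I -> R) (A : {fset I}) :
  partial_sum (fun i => toC (f i) : R[i]^o) A = toC (\sum_(i <- A) f i).
Proof.
by rewrite /partial_sum rmorph_sum /= (big_seq_fsetE _ _ predT (fun i => toC (f i))).
Qed.

Lemma partial_sum_cvg (I : choiceType) (f : I -> R) (x : R) :
    (forall i, 0 <= f i) -> (\esum_(i in [set: I]) (f i)%:E = x%:E)%E ->
  partial_sum (fun i => toC (f i) : R[i]^o) @ totally --> (toC x : R[i]^o).
Proof.
move=> f0 fx; have FF := @totally_filter I.
apply/cvgrPdist_lt => /= e e0.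
(* Positivity in [R[i]] forces a zero imaginary part. *)
have [r r0 er] : exists2 r : R, 0 < r & e = toC r.
  case: e e0 => a b; rewrite ltcE /= => /andP[/eqP -> a0]; by exists a.
have : ((x - r)%:E < \esum_(i in [set: I]) (f i)%:E)%E.
  by rewrite fx lte_fin ltrBlDr ltrDl.
(* One finite set brings the sum above [x - r]; nonnegative terms keep every larger finite sum
   between [x - r] and [x]. *)
case/ereal_sup_gt => _ [X [finX _] <-] hX.
exists (fset_set X) => // B /= XB; rewrite partial_sumE -rmorphB /= er.
have Bx : \sum_(i <- B) f i <= x.
  rewrite -lee_fin -fx -sumEFin; apply: esum_ge; exists [set` B] => //.
  by rewrite fsbig_finite //= set_fsetK.
have xB : x - r < \sum_(i <- B) f i.
  move: hX; rewrite fsbig_finite // sumEFin lte_fin => /lt_le_trans; apply.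
  rewrite [leRHS](big_fsetID _ (mem (fset_set X))) /=.
  rewrite (_ : [fset i in B | i \in fset_set X]%fset = fset_set X).
    by rewrite lerDl; apply: sumr_ge0.
  apply/fsetP => i; rewrite !inE /= andbC.
  by case: (boolP (i \in fset_set X)) => //= /(fsubsetP XB) ->.
rewrite normc_def /= expr0n addr0 sqrtr_sqr ltcR ger0_norm ?subr_ge0 //.
by rewrite ltrBlDr -ltrBlDl.
Qed.

Lemma series_cvg_real (I : choiceType) (f : I -> R) (x : R) :
    (forall i, 0 <= f i) -> (\esum_(i in [set: I]) (f i)%:E = x%:E)%E ->
  series_cvg (fun i => toC (f i)) /\ series_sum (fun i => toC (f i)) = toC x.
Proof.
move=> f0 fx; have FF := @totally_filter I.
have h := partial_sum_cvg f0 fx; split.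
  by apply/cvg_ex; exists (toC x).
exact: cvg_lim h.
Qed.

Lemma esum_sig (T : choiceType) (P : pred T) (f : T -> R) :
  (\esum_(x in [set: {x | P x}]) (f (val x))%:E =
   \esum_(x in [set: T]) ((P x)%:R * f x)%:E)%E.
Proof.
transitivity (\esum_(x in [set x | P x]) (f x)%:E)%E.
  apply/esym/(reindex_esum [set: {x | P x}] [set x | P x] val); split=> /=.
  - by move=> [x Px] _.
  - by move=> x y _ _ /val_inj.
  - by move=> x Px; exists (exist _ x Px).
rewrite esum_mkcond; apply: eq_esum => x _.
have -> : (x \in [set x | P x]) = P x by apply/idP/idP; rewrite inE.
by case: (P x); rewrite ?mul1r ?mul0r.
Qed.

Lemma increasing_rcons r m M :
  increasing r.+1 (rcons m M) = increasing r m && (last 0 m < M)%N.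
Proof. by rewrite /increasing size_rcons eqSS rcons_path andbA. Qed.

Definition Lterm (s : seq (nat * nat)) (m : seq nat) : R :=
  \prod_(i < size s) ((rev [seq x.2%:R^-1 | x <- s])`_i ^+
     (nth 0%N m i - nth 0%N (0%N :: m) i)%N
   / (nth 0%N m i)%:R ^+ nth 0%N (rev (map fst s)) i).

Lemma Lterm_rcons x s m M : size m = size s ->
  Lterm (x :: s) (rcons m M) =
  Lterm s m * (x.2%:R^-1 ^+ (M - last 0%N m) / M%:R ^+ x.1).
Proof.
move=> ms; rewrite /Lterm big_ord_recr /= !rev_cons; congr (_ * _).
  apply: eq_bigr => i _; rewrite -rcons_cons !nth_rcons /= !size_rev !size_map ms.
  by rewrite ltn_ord ltnS ltnW.
rewrite -rcons_cons !nth_rcons /= !size_rev !size_map ms ltnn eqxx ltnSn.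
by rewrite -/(size s) -ms (last_nth 0%N).
Qed.

Lemma kweight_kerL s m :
  kweight (map kerL s) (rev m) = (increasing (size s) m)%:R * Lterm s m.
Proof.
elim: s m => [|x s IHs] m.
  case: m => [|y m]; first by rewrite /Lterm big_ord0 mulr1.
  rewrite rev_cons; case: (rev m) => [|z t] /=; by rewrite mul0r.
case/lastP: m => [|m M]; first by rewrite mul0r.
rewrite rev_rcons /= IHs increasing_rcons.
have -> : head 0%N (rev m) = last 0%N m.
  by case/lastP: m => [//|m y]; rewrite rev_rcons last_rcons.
case: (boolP (increasing (size s) m)) => [/andP[/eqP ms _]|_] /=; last first.
  by rewrite !mul0r mulr0.
rewrite Lterm_rcons // /kerL.
by case: (_ < _)%N; rewrite !(mul0r, mul1r, mulr0) //; ring.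
Qed.

Definition Sterm (l q : seq nat) : R :=
  \prod_(i < size l) ((nth 0%N q i)%:R ^+ nth 0%N (rev l) i)^-1.

Lemma Sterm_rcons c l q M : size q = size l ->
  Sterm (c :: l) (rcons q M) = Sterm l q * (M%:R ^+ c)^-1.
Proof.
move=> ql; rewrite /Sterm big_ord_recr /= !rev_cons; congr (_ * _).
  by apply: eq_bigr => i _; rewrite !nth_rcons size_rev ql ltn_ord.
by rewrite !nth_rcons size_rev ql ltnn eqxx.
Qed.

Lemma kweight_kerS l q : all (leq 1) l ->
  kweight (map kerS l) (rev q) =
  ((size q == size l) && path leq 1%N q)%:R * Sterm l q.
Proof.
elim: l q => [|c l IHl] q.
  case: q => [|y q]; first by rewrite /Sterm big_ord0 mulr1.
  rewrite rev_cons; case: (rev q) => [|z t] /=; by rewrite mul0r.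
move=> /= /andP[c0 lpos]; case/lastP: q => [|q M]; first by rewrite mul0r.
rewrite rev_rcons /= IHl // size_rcons eqSS rcons_path.
have -> : head 0%N (rev q) = last 0%N q.
  by case/lastP: q => [//|q y]; rewrite rev_rcons last_rcons.
case: eqVneq => [ql|_] /=; last by rewrite !mul0r mulr0.
case: (path leq 1 q); last by rewrite !mul0r mulr0.
rewrite Sterm_rcons // /kerS mul1r /=.
case: q {ql} => [|y q] /=; last first.
  by case: (_ <= _)%N; rewrite !(mul0r, mul1r, mulr0) ?mulr1 // mulrC.
case: M => [|M]; last by rewrite /= mul1r mulr1 mulrC.
(* The kernel admits [q_1 = 0], which the path condition excludes; the weight there is [0] since
   [c > 0] and [0^-1 = 0]. *)
by rewrite expr0n -[c]prednK //= invr0 !(mul0r, mulr0).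
Qed.

Lemma Lterm_ge0 s m : 0 <= Lterm s m.
Proof.
apply: prodr_ge0 => i _; rewrite mulr_ge0 ?invr_ge0 ?exprn_ge0 //.
rewrite nth_rev ?size_map // (nth_map (0, 0)%N) ?invr_ge0 //.
by rewrite ltn_subrL; case: (size s) i => [[]//|].
Qed.

Lemma Sterm_ge0 l q : 0 <= Sterm l q.
Proof. by apply: prodr_ge0 => i _; rewrite invr_ge0 exprn_ge0. Qed.

Lemma Li_sh_Lcoef s (x : R) :
    (\esum_(M in [set: nat]) (Lcoef s M)%:E = x%:E)%E ->
  Li_sh (rev (map fst s)) (rev [seq y.2%:R^-1 | y <- s]) = toC x :> R[i].
Proof.
move=> sx; set k := rev (map fst s).
have ks : size k = size s by rewrite size_rev size_map.
have termE (m : seq nat) :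
  \prod_(i < dep k) ((rev [seq y.2%:R^-1 | y <- s])`_i ^+
      (nth 0%N m i - nth 0%N (0%N :: m) i)%N
    / (nth 0%N m i)%:R ^+ nth 0%N k i) = toC (Lterm s m) :> R[i].
  rewrite /Lterm rmorph_prod /dep ks; apply: eq_bigr => i _.
  rewrite rmorphM fmorphV !rmorphXn rmorph_nat; congr (_ ^+ _ / _).
  have -> : [seq y.2%:R^-1 | y <- s] = map toC [seq y.2%:R^-1 | y <- s].
    by rewrite -map_comp; apply: eq_map => y /=; rewrite fmorphV rmorph_nat.
  by rewrite -(map_rev toC) (nth_map 0) // size_rev size_map.
rewrite /Li_sh (_ : (fun m => _) = (fun m => toC (Lterm s (val m)))); last first.
  by apply/funext => m; exact: termE.
apply: (series_cvg_real _ _).2 => [m|]; first exact: Lterm_ge0.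
rewrite (esum_sig (increasing (dep k)) (Lterm s)) -sx -kcoef_kerL.
under [RHS]eq_esum do rewrite -[kcoef _ _]mulr1.
rewrite -(esum_kweight (f := fun=> 1)) //; last first.
  by apply: map_kernel_ok; exact: kerL_ok.
by apply: eq_esum => m _; rewrite mulr1 kweight_kerL /dep ks.
Qed.

Lemma MPL_of_Lcoef p w s (x : R) : mpl_word p w s -> (1 < (head (0, 0) s).1)%N ->
    (\esum_(M in [set: nat]) (Lcoef s M)%:E = x%:E)%E ->
  MPL p w.+1 (toC x).
Proof.
move=> vs hs sx; have lix := Li_sh_Lcoef sx.
case/and4P: vs => sN0 sall /eqP slast /eqP sw.
exists (rev (map fst s)), (behead (rev [seq y.2%:R^-1 | y <- s])).
have zE : rev [seq y.2%:R^-1 | y <- s] =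
    1 :: behead (rev [seq y.2%:R^-1 | y <- s]) :> seq R[i].
  case/lastP: s sN0 slast {hs sall sw sx lix} => [//|s y] _.
  by rewrite last_rcons map_rcons rev_rcons /= => ->; rewrite invr1.
have sw' : sumn (rev (map fst s)) = w by rewrite sumn_rev.
have size_le (u : seq (nat * nat)) :
    all (fun x => (0 < x.1) && (0 < x.2 <= p))%N u -> (size u <= sumn (map fst u))%N.
  elim: u => [//|y u IHu] /= /andP[/andP[y0 _] /IHu hu].
  by rewrite -add1n leq_add.
split.
- rewrite /is_index all_rev all_map; apply: sub_all sall => y /=.
  by case/andP.
- rewrite /dep size_rev size_map lt0n size_eq0 sN0 /=.
  (* The last exponent is at least [2] and the others at least [1], so the depth is strictly below
     the weight. *)
  case: s sN0 hs sall sw {slast sx lix zE sw'} => [//|y s] _ /= hs /andP[_ /size_le].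
  by lia.
- rewrite /admissible; apply/orP; right.
  case: s sN0 hs {sall slast sw sx lix zE sw'} => [//|y s] _ /= hs.
  by rewrite rev_cons last_rcons.
- by rewrite /wt sw' subn1.
- split.
  + by rewrite size_behead /dep !size_rev !size_map subn1.
  + move=> y /mem_behead; rewrite mem_rev => /mapP[z zs ->].
    by exists z.2 => //; move/allP: sall => /(_ z zs) /andP[].
  + by rewrite -zE lix.
Qed.

Lemma Lspan_MPL p w x : Lspan p w x ->
  exists s : seq (int * R[i]),
    (forall y, y \in s -> MPL p w.+1 y.2) /\
    toC x = \sum_(y <- s) y.1%:~R * y.2.
Proof.
elim=> {x} [|s x vs hs sx|x y _ [s1 [s1M s1x]] _ [s2 [s2M s2y]]].
- by exists [::]; split=> //; rewrite big_nil rmorph0.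
- exists [:: (1, toC x)]; split; last by rewrite big_seq1 mul1r.
  by move=> y; rewrite inE => /eqP ->; exact: MPL_of_Lcoef hs sx.
- exists (s1 ++ [seq (- z.1, z.2) | z <- s2]); split.
    move=> z; rewrite mem_cat => /orP[/s1M //|/mapP[z' /s2M h ->]].
    exact: h.
  rewrite rmorphB /= s1x s2y big_cat big_map /= -sumrN; congr (_ + _).
  by apply: eq_bigr => z _; rewrite rmorphN mulNr.
Qed.

(** * The multiple connected sum as a single series *)

Definition ones (k : seq nat) : seq (nat * nat) := rev [seq (c, 1%N) | c <- k].

Lemma size_ones k : size (ones k) = size k.
Proof. by rewrite size_rev size_map. Qed.

Lemma mpl_word_ones k : is_index k -> k <> [::] -> mpl_word 1 (wt k) (ones k).
Proof.
move=> kpos kN0; rewrite /ones; apply/and4P; split.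
- by rewrite -size_eq0 size_ones size_eq0; exact/eqP.
- rewrite all_rev all_map; apply: sub_all kpos => c /= c0.
  by rewrite c0.
- by case: k kN0 {kpos} => [//|c k] _; rewrite /= rev_cons last_rcons.
- by rewrite map_rev sumn_rev -map_comp /= map_id.
Qed.

(** Blocks of the connected sum carry no powers of arguments: this is the case of all arguments
    [1]. *)
Lemma Lterm_ones k m :
  Lterm (ones k) m = \prod_(i < size k) ((nth 0%N m i)%:R ^+ nth 0%N k i)^-1.
Proof.
rewrite /Lterm size_ones; apply: eq_bigr => i _.
rewrite /ones -!map_rev -!map_comp revK /= map_id.
rewrite (nth_map 0%N) //= invr1 expr1n mul1r //.
Qed.

Definition Zreal n (k : 'I_n -> seq nat) (l : seq nat)
    (mq : {ffun 'I_n -> seq nat} * seq nat) : R :=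
  cnctn (fun j => last 0%N (mq.1 j)) * (\prod_(j < n) Lterm (ones (k j)) (mq.1 j)) *
  ((last 0%N mq.2)%:R * Sterm (rev l) mq.2).

Lemma Z_termE n (k : 'I_n -> seq nat) (l : seq nat) (mq : {mq | Z_dom k l mq}) :
  Z_term R[i] mq = toC (Zreal k l (val mq)).
Proof.
rewrite /Z_term /Zreal !rmorphM; congr (_ * _ * (_ * _)).
- by rewrite /connector fmorphV !rmorph_nat.
- rewrite rmorph_prod; apply: eq_bigr => j _; rewrite Lterm_ones rmorph_prod.
  by apply: eq_bigr => i _; rewrite fmorphV rmorphXn rmorph_nat.
- by rewrite rmorph_nat.
- rewrite rmorph_prod size_rev revK.
  by apply: eq_bigr => i _; rewrite fmorphV rmorphXn rmorph_nat.
Qed.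

Lemma Zreal_ge0 n (k : 'I_n -> seq nat) l mq : 0 <= Zreal k l mq.
Proof.
rewrite !mulr_ge0 ?cnctn_ge0 ?Sterm_ge0 //; apply: prodr_ge0 => j _.
exact: Lterm_ge0.
Qed.

Lemma Zreal_kweight n (k : 'I_n -> seq nat) l mq : is_index l ->
  (Z_dom k l mq)%:R * Zreal k l mq =
  \prod_(j < n) kweight (map kerL (ones (k j))) (rev (mq.1 j)) *
  cnctn (fun j => last 0%N (mq.1 j)) *
  (kweight (map kerS (rev l)) (rev mq.2) *
   ((last 0%N mq.2 == (\sum_(j < n) last 0%N (mq.1 j))%N)%:R * (last 0%N mq.2)%:R)).
Proof.
move=> lpos; rewrite kweight_kerS ?all_rev //.
under [in RHS]eq_bigr do rewrite kweight_kerL size_ones.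
rewrite big_split /= /Z_dom size_rev /dep.
have -> : \prod_(j < n) (increasing (size (k j)) (mq.1 j))%:R =
    [forall j, increasing (size (k j)) (mq.1 j)]%:R :> R.
  case: (boolP [forall j, _]) => [/forallP h|/forallPn[j /negPf hj]].
    by rewrite big1 // => j _; rewrite h.
  by rewrite (bigD1 j) //= hj mul0r.
rewrite /Zreal; case: [forall j, _]; rewrite /= ?mul0r //.
case: (size _ == _); rewrite /= ?(mul0r, mulr0) //.
case: (path _ _ _); rewrite /= ?(mul0r, mulr0) //.
by case: (_ == _); rewrite /= ?(mul0r, mulr0) //; ring.
Qed.

Lemma esum_Zreal n (k : 'I_n -> seq nat) l : is_index l ->
  (\esum_(mq in [set: {mq | Z_dom k l mq}]) (Zreal k l (val mq))%:E =
   \esum_(M in [set: nat]) (convn (fun j => Lcoef (ones (k j))) M *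
                            (M%:R * Scoef (rev l) M))%:E)%E.
Proof.
move=> lpos; rewrite (esum_sig (Z_dom k l) (Zreal k l)).
have okL x : forall f, List.In f (map (@kerL R) x) -> kernel_ok f.
  by apply: map_kernel_ok; exact: kerL_ok.
have okS x : forall f, List.In f (map (@kerS R) x) -> kernel_ok f.
  by apply: map_kernel_ok; exact: kerS_ok.
have WL x m : 0 <= kweight (map (@kerL R) x) m by exact: kweight_ge0 (okL x).
have WS x m : 0 <= kweight (map (@kerS R) x) m by exact: kweight_ge0 (okS x).
pose A (m : {ffun 'I_n -> seq nat}) : R :=
  \prod_(j < n) kweight (map kerL (ones (k j))) (rev (m j)) *
  cnctn (fun j => last 0%N (m j)).
have A0 m : 0 <= A m by rewrite mulr_ge0 ?cnctn_ge0 // prodr_ge0.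
pose B (a b : nat) : R := (b == a)%:R * b%:R.
have B0 a b : 0 <= B a b by rewrite mulr_ge0.
transitivity (\esum_(m in [set: {ffun 'I_n -> seq nat}])
    \esum_(q in [set: seq nat]) (A m * (kweight (map kerS (rev l)) (rev q) *
      B (\sum_(j < n) last 0 (m j)) (last 0 q)))%:E)%E.
  rewrite esumT_pair; last first.
    by move=> m q; rewrite lee_fin (mulr_ge0 (A0 m)) // (mulr_ge0 (WS _ _)).
  by apply: eq_esum => mq _; rewrite Zreal_kweight.
rewrite -(esum_family (fun j => ones (k j))
  (F := fun M => M%:R * Scoef (rev l) M)); last first.
  by move=> m; rewrite mulr_ge0 // Scoef_ge0.
apply: eq_esum => m _; rewrite -/(A m); set a := (\sum_(j < n) _)%N.
transitivity ((A m)%:E * \esum_(q in [set: seq nat])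
   (kweight (map kerS (rev l)) (rev q) * B a (last 0 q))%:E)%E.
  by rewrite -esumZl // => q; rewrite lee_fin (mulr_ge0 (WS _ _)).
rewrite (esum_kweight (okS (rev l)) (B0 a)) kcoef_kerS [RHS]EFinM; congr (_ * _)%E.
(* The condition on the last [q] concentrates the sum on the single value [a]. *)
rewrite (esumID [set a]) ?setTI; last first.
  by move=> M _; rewrite lee_fin mulr_ge0 ?Scoef_ge0.
rewrite esum_set1; last by rewrite lee_fin mulr_ge0 ?Scoef_ge0.
rewrite esum1 ?adde0 => [|M /= /eqP/negPf Ma].
  by rewrite /B eqxx mul1r mulrC.
by rewrite /B Ma mul0r mulr0.
Qed.

End Bridge.

(** * Convergence and evaluation of the multiple connected sum *)

Theorem theorem1p1 (R : realType) (n : nat) (hn : (2 <= n)%N)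
    (k : 'I_n -> seq nat) (l : seq nat)
    (hk : forall j, is_index (k j) /\ k j <> [::])
    (hl : is_index l /\ l <> [::]) :
  let w := (\sum_(j < n) wt (k j) + wt l)%N in
  series_cvg (@Z_term R[i] n k l) /\
  exists s : seq (int * R[i]),
    (forall p, p \in s -> MPL n w p.2) /\
    Z_sum R[i] k l = \sum_(p <- s) p.1%:~R * p.2.
Proof.
move=> w; case: hl => lpos lN0.
have vk j : mpl_word 1 (wt (k j)) (ones (k j)) by case: (hk j); exact: mpl_word_ones.
have rlN0 : rev l != [::] by rewrite -size_eq0 size_rev size_eq0; exact/eqP.
have w0 : (0 < w)%N.
  by rewrite /w; case: (l) lN0 lpos => [//|c l'] _ /= /andP[c0 _]; lia.
have [x Zx xL] : eLspan n w.-1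
    (\esum_(mq in [set: {mq | Z_dom k l mq}]) (Zreal k l (val mq) : R)%:E).
  rewrite esum_Zreal //; move: (sumn_rev l) @w w0.
  case: n hn k hk vk => [//|[//|n]] _ k hk vk sl w w0.
  have F0 m : 0 <= m%:R * Scoef (rev l) m :> R by rewrite mulr_ge0 // Scoef_ge0.
  have L0 s m : 0 <= Lcoef s m :> R by exact: Lcoef_ge0.
  (* All blocks but the last are convolved into one sequence. The last stays a word with arguments
     [1], as the transport requires, and adds one to the bound on denominators. *)
  pose f : nat -> R := convn (fun j : 'I_n.+1 => Lcoef (ones (k (lift ord_max j)))).
  have f0 m : 0 <= f m by exact: convn_ge0.
  have fL : zspan n.+1 (\sum_(j < n.+1) wt (k (lift ord_max j))) f.
    exact: (zspan_convn (fun j => vk (lift ord_max j))).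
  have := eLspan_csum_zspan fL f0 (vk ord_max) rlN0; rewrite all_rev => /(_ lpos).
  rewrite csum_conv // sl (_ : (_ + _ + sumn l)%N = w) //.
  by rewrite /w [in RHS]big_ord_recr; under [in RHS]eq_bigr do rewrite widen_lift.
have [Zcvg Zsum] := series_cvg_real (fun mq => Zreal_ge0 k l (val mq)) Zx.
have ZE : @Z_term R[i] n k l = fun mq => real_complex R (Zreal k l (val mq)).
  by apply/funext => mq; exact: Z_termE.
rewrite /Z_sum ZE Zsum; split=> //.
by have := Lspan_MPL xL; rewrite prednK.
Qed.
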